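(* Let $\varepsilon\in\mathbb{R}$ with $0\leq\varepsilon\leq\frac16$ and define $f_\varepsilon:\mathbb{N}\to[0,1]$ by \[ f_\varepsilon(d)=\begin{cases}1 & \text{if } d=0,\\ 1-\varepsilon & \text{if } d=1,\\ \min\left\{\frac35,\frac12+\varepsilon\right\} & \text{if } d=2,\\ \min\left\{\frac{2}{d+1},\frac1d+\varepsilon\right\} & \text{if } d\geq 3.\end{cases} \] Then $\alpha_{\mathcal{S}}(G)\geq \sum_{v\in V(G)} f_\varepsilon(d_G(v))$ holds for every graph $G$. Moreover, this lower bound $f_\varepsilon$ for $\alpha_{\mathcal{S}}$ is extremal, and every lower bound for $\alpha_{\mathcal{S}}$ is dominated by some lower bound of this form (i.e. by $f_{\varepsilon}$ for some $\varepsilon$ with $0\leq\varepsilon\leq\frac16$).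
   Context: All graphs are finite, simple, and undirected; $d_G(v)$ denotes the degree of vertex $v$ in $G$; $\mathbb{N}$ includes $0$. A star is any tree that can be obtained from a single vertex $v$ by adding a (possibly empty) set of new vertices and making them all adjacent to $v$; in particular a single vertex is a star. $\mathcal{S}$ denotes the set of all forests of stars, i.e. forests every connected component of which is a star. Given a class of graphs $\mathcal{C}$ and a graph $G$, $\alpha_{\mathcal{C}}(G)$ denotes the maximum number of vertices of an induced subgraph $H$ of $G$ such that $H$ belongs to $\mathcal{C}$. A function $f:\mathbb{N}\to[0,1]$ is called a lower bound for $\alpha_{\mathcal{C}}$ if $\alpha_{\mathcal{C}}(G)\geq\sum_{v\in V(G)} f(d_G(v))$ holds for all graphs $G$. Such a lower bound $f$ is extremal if there does not exist $g:\mathbb{N}\to[0,1]$ with $g\not\equiv 0$ such that $f+g$ is also a lower bound for $\alpha_{\mathcal{C}}$. A lower bound $f$ is dominated by a lower bound $f'$ if $f(d)\leq f'(d)$ holds for every $d\in\mathbb{N}$. *)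

(* Defs.v *)
From mathcomp Require Import all_boot all_order all_algebra.
From mathcomp Require Import boolp reals.
Set Implicit Arguments.
Unset Strict Implicit.
Unset Printing Implicit Defensive.
Import Order.TTheory GRing.Theory Num.Theory.
Local Open Scope ring_scope.

Record sgraph := SGraph {
  vertex :> finType;
  adj : rel vertex;
  adj_sym : symmetric adj;
  adj_irr : irreflexive adj }.

Definition deg (G : sgraph) (v : G) : nat := #|[set w : G | adj v w]|.

Section Induced.
Variables (G : sgraph) (S : {set G}).

Definition induced_adj : rel {x : G | x \in S} :=
  fun x y => adj (val x) (val y).

Lemma induced_adj_sym : symmetric induced_adj.
Proof. by move=> x y; apply: adj_sym. Qed.

Lemma induced_adj_irr : irreflexive induced_adj.
Proof. by move=> x; apply: adj_irr. Qed.

Definition induced : sgraph := SGraph induced_adj_sym induced_adj_irr.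

End Induced.

Definition component (G : sgraph) (x : G) : {set G} :=
  [set y : G | connect (@adj G) x y].

(* [ucycle] also accepts the sequences [:: x; y] that run back and forth along
   an edge, so a graph cycle is a [ucycle] of size at least 3. *)
Definition is_forest (G : sgraph) : Prop :=
  forall s : seq G, ucycle (@adj G) s -> (size s <= 2)%N.

(* [c] is the initial vertex; the other vertices are the added ones, and the
   edges are exactly those joining [c] to them. Such a graph is always a tree. *)
Definition is_star (G : sgraph) : Prop :=
  exists c : G, forall x y : G,
    adj x y = (x != y) && ((x == c) || (y == c)).

Definition star_forest (G : sgraph) : Prop :=
  is_forest G /\ forall x : G, is_star (induced (component x)).

(* The value is 0 if no induced subgraph of [G] belongs to [C]; this does not
   happen for [star_forest], which contains the empty graph. *)
Definition alpha (C : sgraph -> Prop) (G : sgraph) : nat :=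
  \max_(S : {set G} | `[< C (induced S) >]) #|S|.

Section LowerBounds.
Variable R : realType.
Implicit Types (C : sgraph -> Prop) (f g : nat -> R).

Definition unit_valued f : Prop := forall d : nat, 0 <= f d <= 1.

Definition lower_bound C f : Prop :=
  unit_valued f /\
  forall G : sgraph, (alpha C G)%:R >= \sum_(v : G) f (deg v).

Definition extremal C f : Prop :=
  lower_bound C f /\
  ~ exists g, [/\ unit_valued g,
                  ~ (forall d : nat, g d = 0) &
                  lower_bound C (fun d => f d + g d)].

Definition dominated f g : Prop := forall d : nat, f d <= g d.

Definition f_eps (eps : R) (d : nat) : R :=
  match d with
  | 0%N => 1
  | 1%N => 1 - eps
  | 2%N => Num.min (3 / 5) (1 / 2 + eps)
  | _ => Num.min (2 / (d%:R + 1)) (1 / d%:R + eps)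
  end.

End LowerBounds.

(* Main.v *)
Require Import Defs.
From mathcomp Require Import all_boot all_order all_algebra.
From mathcomp Require Import boolp reals.
From mathcomp Require Import zify ring lra.
Import Order.TTheory GRing.Theory Num.Theory.
Set Implicit Arguments.
Unset Strict Implicit.
Unset Printing Implicit Defensive.
Local Open Scope ring_scope.

(** The lower bound. The induction runs over a set [U] of vertices still to be
    treated and a set [W] of marked vertices. A marked vertex stands for one that
    keeps a private leaf which has already been counted; in a star forest it has
    to be a centre or an isolated vertex. Removing a leaf [u] of [v] from [U] and
    marking [v] costs nothing: [u] is counted as 1, and
    [(1 - eps) + f_eps d <= 1 + 1 / d], where [1 / d] is the weight of a marked
    vertex with [d - 1] remaining neighbours ([packs_leaf]). Only this step depends
    on [eps]. Once no unmarked leaf remains, [f_eps] is at most its value for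
    [eps = 1 / 6] at all degrees that occur ([packs_eps]). So it suffices to treat
    the weights 1, 5/6, 3/5 and then 2/(d+1) of unmarked vertices, and 1/(d+1) of
    marked ones ([packs_sixth]).

    For these weights, consider a smallest counterexample. Where (d+1) times the
    weight is constant, deleting a random vertex of large degree does not lower the
    total weight on average ([packs_heavy]). Hence unmarked vertices have degree at
    most 3 and marked ones degree at most 2. Leaves and isolated vertices are
    removed directly. Deleting single vertices, or keeping a star with two or three
    vertices and deleting its neighbours, then excludes marked vertices of degree 1
    and, in a short case analysis, unmarked vertices of degree 2 ([plain2_packs]).
    What remains has unmarked vertices of degree 3, of weight 1/2, and marked
    vertices of degree 2, of weight 1/3. A maximum cut, in which edges between
    marked vertices count 3/2, splits it into two star forests, and the larger one
    contains half of the vertices ([packs_max_cut]).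

    The other two claims. Complete graphs, the pentagon, and cliques with a pendant
    vertex at each vertex show that every lower bound [f] satisfies
    f(d) <= 2/(d+1), f(2) <= 3/5 and f(d) <= 1/d + (1 - f(1)) for d >= 2. In other
    words, [f] lies below [f_eps] for [eps = 1 - f 1] ([lower_bound_dominated]).
    This gives the domination, with [eps = 1 / 6] if the deficit at leaves is
    larger. It also gives extremality: raising [f_eps] at degree 1 would require
    lowering it at degree 3, and with the value at degree 1 fixed no other value
    can be raised. *)

(** * Sets inducing star forests, with marked vertices *)

Section MarkedStars.
Variable G : sgraph.
Implicit Types (A D S T U W Z : {set G}) (u v x y : G).

Definition nbr U v : {set G} := [set u in U | adj v u].

(** A marked vertex carries an imaginary private leaf, which counts in its
    degree. A graph all of whose edges have an end of degree at most 1 is a star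
    forest, so [star_set W A] says that [A], together with the imaginary leaves
    of its marked vertices, induces a star forest. *)
Definition star_set W A : bool :=
  [forall u in A, forall v in A, adj u v ==>
     ((#|nbr A u| + (u \in W) <= 1)%N || (#|nbr A v| + (v \in W) <= 1)%N)].

Lemma star_setP W A :
  reflect (forall u v, u \in A -> v \in A -> adj u v ->
             (#|nbr A u| + (u \in W) <= 1)%N \/ (#|nbr A v| + (v \in W) <= 1)%N)
          (star_set W A).
Proof.
apply: (iffP forall_inP) => [H u v uA vA uv | H u uA].
  have /forall_inP/(_ v vA)/implyP/(_ uv)/orP[] := H u uA; by [left | right].
apply/forall_inP => v vA; apply/implyP => uv; apply/orP.
by case: (H u v uA vA uv); [left | right].
Qed.

Lemma in_nbr U u v : (u \in nbr U v) = (u \in U) && adj v u.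
Proof. by rewrite inE. Qed.

Lemma nbr_notin U v : v \notin nbr U v.
Proof. by rewrite in_nbr adj_irr andbF. Qed.

Lemma nbrT v : nbr [set: G] v = [set w | adj v w].
Proof. by apply/setP => w; rewrite !inE. Qed.

Lemma card_nbr_split U S v :
  #|nbr U v| = (#|nbr U v :&: S| + #|nbr (U :\: S) v|)%N.
Proof.
rewrite -(cardsID S (nbr U v)); congr (_ + #|pred_of_set _|)%N.
by apply/setP => u; rewrite !inE andbA.
Qed.

Lemma star_setU W T A :
  (forall u v, u \in T -> v \in A -> ~~ adj u v) ->
  star_set W T -> star_set W A -> star_set W (T :|: A).
Proof.
move=> noTA /star_setP sT /star_setP sA; apply/star_setP.
have nT u : u \in T -> nbr (T :|: A) u = nbr T u.
  move=> uT; apply/setP => v; rewrite !inE.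
  by case vA: (v \in A); rewrite ?orbF // (negbTE (noTA _ _ uT vA)) !andbF.
have nA u : u \in A -> nbr (T :|: A) u = nbr A u.
  move=> uA; apply/setP => v; rewrite !inE adj_sym.
  by case vT: (v \in T); rewrite //= (negbTE (noTA _ _ vT uA)) andbF.
move=> u v; rewrite !inE => /orP[uT|uA] /orP[vT|vA] uv.
- by rewrite !nT //; apply: sT.
- by have := noTA _ _ uT vA; rewrite uv.
- by have := noTA _ _ vT uA; rewrite adj_sym uv.
- by rewrite !nA //; apply: sA.
Qed.

Lemma star_set0 W : star_set W set0.
Proof. by apply/star_setP => u v; rewrite inE. Qed.

Lemma star_set1 W v : star_set W [set v].
Proof. by apply/star_setP => u w /set1P-> /set1P->; rewrite adj_irr. Qed.

Lemma star_set_center W c (L : {set G}) :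
  {in L &, forall u v, ~~ adj u v} ->
  [disjoint c |: L & W] -> star_set W (c |: L).
Proof.
move=> indL /disjoint_setI0 dW.
have leaf l : l \in L -> (#|nbr (c |: L) l| + (l \in W) <= 1)%N.
  move=> lL; have -> : l \in W = false.
    by apply/negP => lW; have := in_set0 l; rewrite -dW !inE lW lL orbT.
  rewrite addn0 -(cards1 c) subset_leq_card //; apply/subsetP => u.
  rewrite !inE => /andP[/orP[//|uL] lu].
  by have := indL _ _ lL uL; rewrite lu.
apply/star_setP => u v; rewrite !in_setU1 => /orP[/eqP->|uL] /orP[/eqP->|vL].
- by rewrite adj_irr.
- by right; apply: leaf.
- by left; apply: leaf.
- by left; apply: leaf.
Qed.

(** The vertex [u] takes the place of the imaginary leaf of [v]. If [v] was
    marked before, one of the two leaves was not accounted for, but then the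
    imaginary leaf forces every edge at [v] to have its other end of degree 1
    anyway. *)
Lemma star_set_leaf W A u v :
  nbr (u |: A) u \subset [set v] -> u \notin A -> u \notin W ->
  star_set (v |: W) A -> star_set W (u |: A).
Proof.
move=> nu uA uW /star_setP sA; apply/star_setP.
have leaf_u : (#|nbr (u |: A) u| + (u \in W) <= 1)%N.
  by rewrite (negbTE uW) addn0 -(cards1 v) subset_leq_card.
have adju a : a \in A -> adj u a -> a = v.
  move=> aA ua; apply/set1P; apply: (subsetP nu); rewrite !inE aA ua.
  by rewrite orbT.
have far a : a \in A -> a != v -> nbr (u |: A) a = nbr A a.
  move=> aA av; apply/setP => b; rewrite !inE.
  case: eqP => [->|//] /=; rewrite (negbTE uA) /=; apply/negP => au.
  by move/eqP: av; apply; apply: adju; rewrite // adj_sym.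
have step a b : a \in A -> b \in A -> adj a b -> a != v ->
  (#|nbr A a| + (a \in v |: W) <= 1)%N -> (#|nbr (u |: A) a| + (a \in W) <= 1)%N.
  by move=> aA bA ab av; rewrite far // !inE (negbTE av).
have big a b : a \in A -> b \in A -> adj a b -> a = v ->
  (#|nbr A a| + (a \in v |: W) <= 1)%N -> False.
  move=> aA bA ab av; rewrite {2}av setU11 addn1 ltnS leqn0 cards_eq0 => /eqP e0.
  by have := in_set0 b; rewrite -e0 in_nbr bA ab.
move=> a b; rewrite !in_setU1.
move=> /orP[/eqP->|aA]; first by left.
move=> /orP[/eqP->|bA] ab; first by right.
have ba : adj b a by rewrite adj_sym.
case: (sA a b aA bA ab) => [la|lb].
  case: (eqVneq a v) => [av|av]; first by case: (big a b aA bA ab av la).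
  by left; apply: step aA bA ab av la.
case: (eqVneq b v) => [bv|bv]; first by case: (big b a bA aA ba bv lb).
by right; apply: step bA aA ba bv lb.
Qed.

End MarkedStars.

(** * Vertex weights *)

(* For denominators that are sums of nonnegative variables and positive
   constants. *)
Ltac fieldpos :=
  field; do ?[apply/andP; split]; apply: lt0r_neq0; lra.

Section Weights.
Variable R : realType.
Implicit Types (eps : R) (b : bool) (d k : nat).

(** The marked vertices get the weight of the Caro-Wei bound on independent
    sets. *)
Definition weight eps b d : R := if b then d.+1%:R^-1 else f_eps eps d.

Lemma f_eps1 eps : f_eps eps 1 = 1 - eps.
Proof. by []. Qed.

(** The cap is the value that complete graphs force; at [d = 2] the pentagon
    forces the smaller value [3 / 5]. *)
Lemma f_eps_le_cap eps d : (3 <= d)%N ->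
  f_eps eps d <= 2 / (d%:R + 1).
Proof. by case: d => [|[|[|d]]] // _; rewrite /f_eps ge_min lexx. Qed.

Lemma f_eps_le_inv eps d : (2 <= d)%N -> f_eps eps d <= 1 / d%:R + eps.
Proof. by case: d => [|[|[|d]]] // _; rewrite /f_eps ge_min lexx orbT. Qed.

(** At [eps = 1 / 6] the cap wins for every [d >= 3]: the difference of the two
    terms is a multiple of [(d - 2) * (d - 3)]. *)
Lemma f_sixth_cap d : (3 <= d)%N -> f_eps (1 / 6) d = 2 / (d%:R + 1) :> R.
Proof.
case: d => [|[|[|d]]] // _; rewrite /f_eps min_l //.
have d0 : 0 <= d%:R :> R by exact: ler0n.
rewrite -addn3 natrD; move: (d%:R : R) d0 => x x0.
have -> : 1 / (x + 3) + 1 / 6 =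
  2 / (x + 3 + 1) + (x ^+ 2 + x) / (6 * (x + 3) * (x + 3 + 1)).
  by fieldpos.
by rewrite lerDl divr_ge0 ?mulr_ge0 // ?exprn_ge0 //; nra.
Qed.

Lemma f_sixth2 : f_eps (1 / 6) 2 = 3 / 5 :> R.
Proof. by rewrite /f_eps min_l //; lra. Qed.

Lemma f_eps_le_sixth eps d : 0 <= eps <= 1 / 6 -> d != 1%N ->
  f_eps eps d <= f_eps (1 / 6) d.
Proof.
case/andP=> e0 e1; case: d => [|[|[|d]]] // _; first by rewrite f_sixth2 ge_min lexx.
by rewrite f_sixth_cap // f_eps_le_cap.
Qed.

(** How much the weight of a vertex of degree [d] grows when a neighbour is
    deleted. *)
Definition gain b d : R := weight (1 / 6) b d.-1 - weight (1 / 6) b d.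

(** From these degrees on the gain is at most [1 / 10] and [(d + 1) * weight] no
    longer changes with [d]; below them the gain is at least [1 / 10]. *)
Definition heavy b d : bool := if b then (3 <= d)%N else (4 <= d)%N.

Lemma gain_heavy b d : heavy b d ->
  gain b d <= 1 / 10 /\ weight (1 / 6) b d = d%:R * gain b d.
Proof.
rewrite /gain /weight; case: b => /=.
  case: d => [|[|[|d]]] // _ /=.
  have d0 : 0 <= d%:R :> R by exact: ler0n.
  rewrite -!(addn1 d.+3) -(addn3 d) !natrD; move: (d%:R : R) d0 => x x0.
  have -> : (x + 3)^-1 - (x + 3 + 1)^-1 = ((x + 3) * (x + 3 + 1))^-1.
    by fieldpos.
  split; last by fieldpos.
  by rewrite div1r lef_pV2 ?posrE; nra.
case: d => [|[|[|[|d]]]] // _; rewrite !f_sixth_cap //=.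
have d0 : 0 <= d%:R :> R by exact: ler0n.
rewrite -(addn1 d.+3) -(addn3 d) !natrD; move: (d%:R : R) d0 => x x0.
have -> : 2 / (x + 3 + 1) - 2 / (x + 3 + 1 + 1) = 2 / ((x + 4) * (x + 5)).
  by fieldpos.
split; last by fieldpos.
by rewrite ler_pdivrMr; nra.
Qed.

Lemma weight0 b : weight (1 / 6) b 0 = 1.
Proof. by case: b; rewrite /weight ?invr1. Qed.

Lemma weightW1 : weight (1 / 6) true 1 = 1 / 2.
Proof. by rewrite /weight div1r. Qed.

Lemma weightW2 : weight (1 / 6) true 2 = 1 / 3.
Proof. by rewrite /weight div1r. Qed.

Lemma weightN1 : weight (1 / 6) false 1 = 5 / 6.
Proof. by rewrite /weight /f_eps; lra. Qed.

Lemma weightN2 : weight (1 / 6) false 2 = 3 / 5.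
Proof. exact: f_sixth2. Qed.

Lemma weightN3 : weight (1 / 6) false 3 = 1 / 2.
Proof. by rewrite /weight f_sixth_cap //; field. Qed.

Definition light_weights := (weight0, weightW1, weightW2, weightN1, weightN2, weightN3).

(** Iterating the gain: a light vertex that loses [k] neighbours at once gains at
    least [k / 10], which makes it possible to count the gains by edges. *)
Lemma weight_light_sub b d k : ~~ heavy b d -> (k <= d)%N ->
  k%:R / 10 <= weight (1 / 6) b (d - k) - weight (1 / 6) b d.
Proof.
by case: b; case: d => [|[|[|[|d]]]] //; case: k => [|[|[|[|k]]]] // _ _;
  rewrite ?(subSS, subn0) !light_weights; lra.
Qed.

Lemma gain_light b d : ~~ heavy b d -> (0 < d)%N -> 1 / 10 <= gain b d.
Proof.
by move=> h d0; have := weight_light_sub h d0; rewrite subn1.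
Qed.

(** The leaf counts 1 once it is removed, and its neighbour becomes a marked
    vertex of degree [d - 1], of weight [1 / d]. This is where the term
    [1 / d + eps] of [f_eps] is used. *)
Lemma weight_leaf eps b d : 0 <= eps -> (0 < d)%N ->
  weight eps false 1 + weight eps b d <= 1 + weight eps true d.-1.
Proof.
move=> e0; rewrite /weight; case: b; case: d => [|d] // _.
  have : (d.+2%:R : R)^-1 <= d.+1%:R^-1 by rewrite lef_pV2 ?posrE ?ltr0n ?ler_nat.
  rewrite !f_eps1 succnK.
  by move: (d.+2%:R^-1) (d.+1%:R^-1) => a c; lra.
case: d => [|d]; first by rewrite !f_eps1 invr1; lra.
rewrite f_eps1.
have := @f_eps_le_inv eps d.+2 isT.
by rewrite div1r succnK; move: (f_eps _ _) (d.+2%:R^-1) => a c; lra.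
Qed.

End Weights.

(** * Reductions that leave smaller vertex sets *)

Section Packing.
Variables (R : realType) (G : sgraph).
Implicit Types (A D S T U W Z : {set G}) (u v x y : G) (eps : R).

Definition wt eps U W u : R := weight eps (u \in W) #|nbr U u|.

(** The property proved for all [U] and [W] by induction on the size of [U];
    degrees are counted inside [U]. *)
Definition packs eps U W : Prop :=
  exists A, [/\ A \subset U, star_set W A & \sum_(u in U) wt eps U W u <= #|A|%:R].

(** The general reduction: keep [T], delete the rest of [S], and apply the
    induction hypothesis outside [S]. The weight lost in [S] has to be paid by
    the vertices of [T] and by the gains outside [S]. *)
Lemma packs_take eps U W T S : T \subset S -> S \subset U -> star_set W T ->
  (forall t, t \in T -> nbr U t \subset S) -> packs eps (U :\: S) W ->
  \sum_(u in S) wt eps U W u <=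
    #|T|%:R + \sum_(u in U :\: S) (wt eps (U :\: S) W u - wt eps U W u) ->
  packs eps U W.
Proof.
move=> TS SU sT cT [A [AU sA leA]] leS.
have noTA u v : u \in T -> v \in A -> ~~ adj u v.
  move=> uT vA; apply/negP => uv; have := subsetP AU v vA.
  rewrite inE => /andP[vS vU]; case/negP: vS.
  by apply: (subsetP (cT u uT)); rewrite in_nbr vU.
exists (T :|: A); split.
- by rewrite subUset (subset_trans TS SU) (subset_trans AU) // subsetDl.
- exact: star_setU.
have dTA : [disjoint T & A].
  apply/pred0P => u /=; apply/negP => /andP[uT uA].
  by have := subsetP AU u uA; rewrite inE (subsetP TS).
have /eqP cTA := (leq_card_setU T A).2; rewrite dTA in cTA.
rewrite cTA natrD (big_setID S) /= (setIidPr SU).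
move: leS leA; rewrite sumrB.
set a := \sum_(i in S) _; set b := \sum_(i in _) wt eps U W i.
by set c := \sum_(i in _) wt _ _ _ _; move: a b c => a b c; lra.
Qed.

Lemma packs_leaf eps U W u v : 0 <= eps -> u \in U -> u \notin W ->
  nbr U u = [set v] -> packs eps (U :\ u) (v |: W) -> packs eps U W.
Proof.
move=> e0 uU uW nu [A [AU sA leA]].
have /[!in_nbr]/andP[vU uv] : v \in nbr U u by rewrite nu set11.
have uA : u \notin A by apply/negP => /(subsetP AU); rewrite !inE eqxx.
have uvN : u != v by apply/eqP => e; move: uv; rewrite e adj_irr.
have uAU : u |: A \subset U.
  by rewrite subUset sub1set uU (subset_trans AU) // subD1set.
exists (u |: A); split => //.
- apply: star_set_leaf sA => //; rewrite -nu.
  by apply/subsetP => a; rewrite !in_nbr => /andP[/(subsetP uAU) -> ->].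
rewrite cardsU1 uA natrD; apply: le_trans (lerD (lexx _) leA).
rewrite (big_setD1 u) //= (big_setD1 v) ?inE 1?eq_sym ?uvN //=.
rewrite [X in _ <= _ + X](big_setD1 v) ?inE 1?eq_sym ?uvN //= !addrA.
apply: lerD; last first.
  apply: ler_sum => a /setD1P[av /setD1P[au aU]].
  rewrite /wt in_setU1 (negbTE av) /=; rewrite le_eqVlt; apply/predU1P; left; congr (weight _ _ #|pred_of_set _|).
  apply/setP => b; rewrite !inE; case: eqP => //= ->; apply/negP => /andP[_ au'].
  have : a \in nbr U u by rewrite in_nbr aU adj_sym.
  by rewrite nu inE (negbTE av).
have uNv : u \in nbr U v by rewrite in_nbr uU adj_sym.
rewrite /wt nu cards1 (negbTE uW) setU11.
have -> : nbr (U :\ u) v = nbr U v :\ u by apply/setP => b; rewrite !inE andbA.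
rewrite (cardsD1 u (nbr U v)) uNv.
by have := weight_leaf (v \in W) e0 (ltn0Sn #|nbr U v :\ u|).
Qed.

Lemma packs_isolated eps U W v : v \in U -> nbr U v = set0 ->
  packs eps (U :\ v) W -> packs eps U W.
Proof.
move=> vU nv pk.
apply: (@packs_take eps U W [set v] [set v]); rewrite ?sub1set ?set11 ?star_set1 //.
  by move=> t /set1P->; rewrite nv sub0set.
rewrite big_set1 cards1 {1}/wt nv cards0 big1 ?addr0.
  by rewrite /weight; case: ifP; rewrite ?invr1.
move=> u /setD1P[uv uU]; rewrite /wt; apply/eqP; rewrite subr_eq0; apply/eqP.
congr (weight _ _ #|pred_of_set _|); apply/setP => w; rewrite !inE.
case: eqP => //= ->; apply/esym/negP => /andP[_ vu].
by have := in_set0 u; rewrite -nv in_nbr uU adj_sym vu.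
Qed.

Lemma sum_nbr_exchange (A B : {set G}) (F : G -> G -> R) :
  \sum_(v in A) \sum_(u in nbr B v) F u v =
  \sum_(u in B) \sum_(v in nbr A u) F u v.
Proof.
rewrite (exchange_big_dep (mem B)) /=; last by move=> v u _ /[!in_nbr]/andP[].
apply: eq_bigr => u uB; apply: eq_bigl => v; by rewrite !in_nbr uB adj_sym.
Qed.

Local Notation w6 := (wt (1 / 6)).
Definition gain_at U W u : R := gain R (u \in W) #|nbr U u|.

Lemma packs_delete U W v : v \in U -> packs (1 / 6) (U :\ v) W ->
  w6 U W v <= \sum_(u in nbr U v) gain_at U W u -> packs (1 / 6) U W.
Proof.
move=> vU pk le; apply: (@packs_take _ U W set0 [set v]) => //.
- by rewrite sub0set.
- by rewrite sub1set.
- exact: star_set0.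
- by move=> t; rewrite inE.
rewrite big_set1 cards0 add0r; apply: le_trans le _; rewrite le_eqVlt; apply/predU1P; left.
rewrite [RHS](bigID (fun u => adj v u)) /= [X in _ + X]big1 ?addr0; last first.
  move=> u /andP[/setD1P[uv uU] nadj]; apply/eqP; rewrite subr_eq0; apply/eqP.
  congr (weight _ _ #|pred_of_set _|); apply/setP => w; rewrite !inE.
  by case: eqP => //= ->; rewrite adj_sym (negbTE nadj) andbF.
apply: eq_big => [u|u /[!in_nbr]/andP[uU vu]].
  by rewrite !inE; case: eqP => //= ->; rewrite adj_irr andbF.
rewrite /gain_at /gain /wt; congr (weight _ _ _ - _).
have vN : v \in nbr U u by rewrite in_nbr vU adj_sym.
by rewrite (cardsD1 v (nbr U u)) vN /=; apply: eq_card => w; rewrite !inE andbA.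
Qed.

(** Choose the deleted vertex uniformly among the heavy vertices. The weight of
    a heavy vertex [v] is its degree times its gain, so the expected change of
    the total weight is a sum of gain differences along the edges that leave
    heavy vertices. These differences cancel between two heavy vertices, and
    they are nonnegative on the edges from a heavy to a light vertex. Hence some
    deletion does not lower the total weight. *)
Lemma packs_heavy U W (x0 : G) :
  (forall v, v \in U -> packs (1 / 6) (U :\ v) W) ->
  x0 \in U -> heavy (x0 \in W) #|nbr U x0| -> packs (1 / 6) U W.
Proof.
move=> IH x0U hx0; pose X := [set v in U | heavy (v \in W) #|nbr U v|].
have x0X : x0 \in X by rewrite inE x0U.
have [v vX le] : exists2 v, v \in X & w6 U W v <= \sum_(u in nbr U v) gain_at U W u.
  apply: contrapT => no.
  have : \sum_(v in X) \sum_(u in nbr U v) gain_at U W u < \sum_(v in X) w6 U W v.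
    apply: ltr_sum; first by apply/hasP; exists x0; rewrite ?mem_index_enum.
    by move=> v vX; rewrite ltNge; apply/negP => le; apply: no; exists v.
  apply/negP; rewrite -leNgt.
  have -> : \sum_(v in X) w6 U W v = \sum_(v in X) \sum_(u in nbr U v) gain_at U W v.
    apply: eq_bigr => v /[!inE]/andP[vU /(@gain_heavy R)[_ e]].
    by rewrite sumr_const /wt e mulr_natl.
  rewrite -subr_ge0 -sumrB.
  have XU v : nbr U v :&: X = nbr X v.
    by apply/setP => u; rewrite !inE; case: (u \in U); rewrite ?andbF // andbC.
  have inside : \sum_(v in X) \sum_(u in nbr U v :&: X) (gain_at U W u - gain_at U W v) = 0.
    under eq_bigr do rewrite XU sumrB.
    by rewrite sumrB sum_nbr_exchange subrr.
  under eq_bigr do rewrite -sumrB (big_setID X) /=.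
  rewrite big_split /= inside add0r; apply: sumr_ge0 => v.
  move=> /[!inE]/andP[vU /(@gain_heavy R)[lev _]].
  apply: sumr_ge0 => u /[!inE]/andP[+ /andP[uU vu]]; rewrite uU /= => hu.
  rewrite subr_ge0; apply: le_trans lev _; apply: gain_light hu _.
  by apply/card_gt0P; exists v; rewrite in_nbr vU adj_sym.
apply: packs_delete le; last apply: IH; by move: vX; rewrite inE => /andP[].
Qed.
End Packing.

(** * Keeping a star and deleting its neighbours *)

Section LightGraphs.
Variables (R : realType) (G : sgraph).
Implicit Types (A D S T Z : {set G}) (u v x y : G).
Variables (U W : {set G}).
Hypothesis IH : forall U' W' : {set G}, (#|U'| < #|U|)%N -> packs (1 / 6 : R) U' W'.
Hypothesis light : forall u, u \in U -> ~~ heavy (u \in W) #|nbr U u|.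

Local Notation w6 := (wt (1 / 6 : R) U W).

Lemma packs_smaller S : S \subset U -> S != set0 -> packs (1 / 6 : R) (U :\: S) W.
Proof.
move=> SU S0; apply: IH; rewrite cardsD (setIidPr SU).
by have := subset_leq_card SU; move: S0; rewrite -card_gt0; lia.
Qed.

Definition closed_nbr T : {set G} := T :|: \bigcup_(t in T) nbr U t.

(** The weight of [d], less the gains that its deletion brings outside the
    closed neighbourhood of [T], each estimated by [1 / 10]. *)
Definition cost T d : R := w6 d - #|nbr U d :\: closed_nbr T|%:R / 10.

(** [packs_take] for [S] the closed neighbourhood of [T]. Each edge between a
    deleted vertex and a surviving one yields at least [1 / 10]. *)
Lemma packs_closed_nbr T : T \subset U -> T != set0 -> star_set W T ->
  \sum_(t in T) w6 t + \sum_(d in closed_nbr T :\: T) cost T d <= #|T|%:R ->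
  packs (1 / 6 : R) U W.
Proof.
move=> TU T0 sT le; set S := closed_nbr T in le.
have TS : T \subset S by apply: subsetUl.
have SU : S \subset U.
  rewrite subUset TU; apply/bigcupsP => t _.
  by apply/subsetP => u /[!in_nbr]/andP[].
have nTS t : t \in T -> nbr U t \subset S.
  by move=> tT; apply: subset_trans (bigcup_sup t tT) (subsetUr _ _).
apply: (packs_take TS SU sT nTS).
  by apply: packs_smaller => //; apply: contraNneq T0 => S0; rewrite -subset0 -S0.
rewrite (big_setID T) /= (setIidPr TS).
apply: (@le_trans _ _ (#|T|%:R + \sum_(u in U :\: S) #|nbr S u|%:R / 10)).
  rewrite -mulr_suml.
  have -> : \sum_(u in U :\: S) #|nbr S u|%:R =
            \sum_(d in S :\: T) #|nbr U d :\: S|%:R :> R.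
    transitivity (\sum_(u in U :\: S) \sum_(d in nbr S u) 1 : R).
      by apply: eq_bigr => u _; rewrite sumr_const.
    rewrite sum_nbr_exchange (big_setID T) /= (setIidPr TS) big1 ?add0r.
      apply: eq_bigr => d _; rewrite sumr_const; congr (_%:R).
      by apply: eq_card => u; rewrite !inE andbA.
    move=> t tT; rewrite big1 // => u; rewrite in_nbr in_setD => /andP[/andP[uS uU] tu].
    by case/negP: uS; apply: (subsetP (nTS t tT)); rewrite in_nbr uU.
  by move: le; rewrite /cost sumrB -mulr_suml addrA lerBlDr.
rewrite lerD2l; apply: ler_sum => u /setDP[uU uS].
have e := card_nbr_split U S u.
have eS : nbr U u :&: S = nbr S u.
  apply/setP => d; rewrite in_setI !in_nbr andbC.
  by case dS: (d \in S); rewrite //= (subsetP SU).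
rewrite eS in e.
have := @weight_light_sub R _ _ #|nbr S u| (light uU).
by rewrite {2}/wt {1}/wt e leq_addr addKn; apply.
Qed.

(** The list may contain repetitions and elements outside [A]; this spares the
    discussion of coincidences between the deleted vertices. *)
Lemma sum_set_le_seq (A : {set G}) (s : seq (G * R)) (F : G -> R) :
  {subset A <= unzip1 s} -> {in s, forall p, F p.1 <= p.2 /\ 0 <= p.2} ->
  \sum_(u in A) F u <= \sum_(p <- s) p.2.
Proof.
elim: s A => [|[a k] s IHs] A sA Fs.
  by rewrite big_nil big1 // => u /sA.
have [/= Fa k0] := Fs _ (mem_head _ _).
rewrite big_cons; apply: (@le_trans _ _ (k + \sum_(u in A :\ a) F u)).
  case aA: (a \in A); first by rewrite (big_setD1 a) // lerD2r.
  suff -> : A :\ a = A by rewrite lerDr.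
  by apply/setP => u; rewrite !inE; case: eqP => // ->; rewrite aA.
rewrite lerD2l; apply: IHs => [u /setD1P[ua /sA]|p ps].
  by rewrite inE (negbTE ua).
by apply: Fs; rewrite inE ps orbT.
Qed.

Lemma cost_le_wt T d : cost T d <= w6 d.
Proof. by rewrite /cost lerBlDr lerDl divr_ge0. Qed.

Lemma cost_le T d Z k : nbr U d :&: closed_nbr T \subset Z -> (#|Z| <= k)%N ->
  cost T d <= w6 d - (#|nbr U d|%:R - k%:R) / 10.
Proof.
move=> sZ Zk; rewrite /cost; apply: lerB => //; rewrite ler_pM2r ?invr_gt0 //.
rewrite lerBlDr -natrD ler_nat -(cardsID (closed_nbr T) (nbr U d)) addnC leq_add2l.
exact: leq_trans (subset_leq_card sZ) Zk.
Qed.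

(** The form in which the reduction is applied: keep the star with centre [c]
    and leaves [L], and list the possible further neighbours with upper bounds on
    their costs. *)
Lemma packs_star c (L : {set G}) (s : seq (G * R)) :
  c \in U -> L \subset nbr U c -> {in L &, forall u v, ~~ adj u v} ->
  [disjoint c |: L & W] ->
  closed_nbr (c |: L) \subset (c |: L) :|: [set d in unzip1 s] ->
  {in s, forall p, cost (c |: L) p.1 <= p.2 /\ 0 <= p.2} ->
  w6 c + \sum_(l in L) w6 l + \sum_(p <- s) p.2 <= #|L|%:R + 1 ->
  packs (1 / 6 : R) U W.
Proof.
move=> cU Lc indL dW /subsetP Ss sP le.
have cL : c \notin L by apply/negP => /(subsetP Lc); rewrite (negbTE (nbr_notin U c)).
apply: (@packs_closed_nbr (c |: L)).
- rewrite subUset sub1set cU; apply: subset_trans Lc _.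
  by apply/subsetP => u /[!in_nbr]/andP[].
- by apply/set0Pn; exists c; rewrite setU11.
- exact: star_set_center.
rewrite big_setU1 //= cardsU1 cL natrD [1%:R + _]addrC; apply: le_trans le.
rewrite lerD2l; apply: sum_set_le_seq => // d /setDP[/Ss dS dT].
by move: dS; rewrite in_setU (negbTE dT) inE.
Qed.

Lemma closed_nbr_pair c l : closed_nbr [set c; l] = [set c; l] :|: (nbr U c :|: nbr U l).
Proof. by rewrite /closed_nbr bigcup_setU !big_set1. Qed.

Lemma closed_nbr_triple c l m :
  closed_nbr (c |: [set l; m]) =
  (c |: [set l; m]) :|: (nbr U c :|: (nbr U l :|: nbr U m)).
Proof. by rewrite /closed_nbr !bigcup_setU !big_set1. Qed.

(** Deleting a single vertex, where only the gains of the neighbours in [Z] are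
    computed exactly. *)
Lemma packs_delete_light v Z : v \in U -> Z \subset nbr U v ->
  w6 v <= \sum_(u in Z) gain_at R U W u + (#|nbr U v|%:R - #|Z|%:R) / 10 ->
  packs (1 / 6 : R) U W.
Proof.
move=> vU Zv le; apply: (packs_delete vU).
  by apply: packs_smaller; rewrite ?sub1set //; apply/set0Pn; exists v; rewrite set11.
apply: le_trans le _; rewrite [leRHS](big_setID Z) /= (setIidPr Zv) lerD2l.
have -> : #|nbr U v|%:R - #|Z|%:R = #|nbr U v :\: Z|%:R :> R.
  by rewrite cardsD (setIidPr Zv) natrB // subset_leq_card.
have -> : #|nbr U v :\: Z|%:R / 10 = \sum_(u in nbr U v :\: Z) (1 / 10) :> R.
  by rewrite sumr_const -[RHS]mulr_natl div1r.
apply: ler_sum => u /[!inE]/andP[_ /andP[uU vu]].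
apply: gain_light; first exact: light.
by apply/card_gt0P; exists v; rewrite in_nbr vU adj_sym.
Qed.

End LightGraphs.

(** * Excluding unmarked vertices of degree two *)

Section SetEnum.
Variable T : finType.
Implicit Types (A : {set T}) (x : T).

Lemma card_pair x y : x != y -> #|[set x; y]| = 2%N.
Proof. by move=> xy; rewrite cards2 xy. Qed.

Lemma set2_other A x : x \in A -> #|A| = 2%N -> exists2 y, y != x & A = [set x; y].
Proof.
move=> xA; rewrite (cardsD1 x) xA => -[/eqP/cards1P[y e]].
have : y \in A :\ x by rewrite e set11.
by rewrite in_setD1 => /andP[yx _]; exists y => //; rewrite -[LHS](setD1K xA) e.
Qed.

Lemma set3_other A x y : x \in A -> y \in A -> x != y -> #|A| = 3%N ->
  exists z, [/\ z != x, z != y & A = x |: [set y; z]].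
Proof.
move=> xA yA xy; rewrite (cardsD1 x) xA => -[].
case/(set2_other (x := y)) => [|z zy e]; first by rewrite !inE eq_sym xy.
have : z \in A :\ x by rewrite e !inE eqxx orbT.
rewrite in_setD1 => /andP[zx _]; exists z; split=> //.
by rewrite -[LHS](setD1K xA) e.
Qed.

Lemma set3_others A x : x \in A -> #|A| = 3%N ->
  exists y z, [/\ y != x, z != x, z != y & A = x |: [set y; z]].
Proof.
move=> xA A3; have : (0 < #|A :\ x|)%N by have := cardsD1 x A; rewrite xA A3; lia.
case/card_gt0P => y /setD1P[yx yA].
have [|z [zx zy e]] := @set3_other A x y xA yA _ A3; first by rewrite eq_sym.
by exists y, z.
Qed.

End SetEnum.

(* Inclusions between explicit sets reduce to propositional tautologies in the
   equations between an element and the listed vertices. *)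
Ltac split_eqs d :=
  repeat match goal with |- context [d == ?a] => case: (d == a) => //= end; by [].

Section Subcubic.
Variables (R : realType) (G : sgraph).
Implicit Types (A D S T Z : {set G}) (u v x y : G).
Variables (U W : {set G}).
Hypothesis IH : forall U' W' : {set G}, (#|U'| < #|U|)%N -> packs (1 / 6 : R) U' W'.
Hypothesis light : forall u, u \in U -> ~~ heavy (u \in W) #|nbr U u|.

Local Notation w6 := (wt (1 / 6 : R) U W).
Local Notation pk := (packs (1 / 6 : R) U W).
Local Notation cost := (cost R U W).
Local Notation closed_nbr := (closed_nbr U).

Definition plain k u := [&& u \in U, u \notin W & #|nbr U u| == k].
Definition marked k u := [&& u \in U, u \in W & #|nbr U u| == k].

Arguments plain k%_N u.
Arguments marked k%_N u.

Lemma wt_plain2 u : plain 2 u -> w6 u = 3 / 5.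
Proof. by case/and3P=> _ /negbTE uW /eqP e; rewrite /wt uW e weightN2. Qed.
Lemma wt_plain3 u : plain 3 u -> w6 u = 1 / 2.
Proof. by case/and3P=> _ /negbTE uW /eqP e; rewrite /wt uW e weightN3. Qed.
Lemma wt_marked1 u : marked 1 u -> w6 u = 1 / 2.
Proof. by case/and3P=> _ uW /eqP e; rewrite /wt uW e weightW1. Qed.
Lemma wt_marked2 u : marked 2 u -> w6 u = 1 / 3.
Proof. by case/and3P=> _ uW /eqP e; rewrite /wt uW e weightW2. Qed.

Lemma gain_plain2 u : plain 2 u -> gain_at R U W u = 7 / 30.
Proof. by case/and3P=> _ /negbTE uW /eqP e; rewrite /gain_at /gain uW e !light_weights; lra. Qed.
Lemma gain_marked1 u : marked 1 u -> gain_at R U W u = 1 / 2.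
Proof. by case/and3P=> _ uW /eqP e; rewrite /gain_at /gain uW e !light_weights; lra. Qed.
Lemma gain_marked2 u : marked 2 u -> gain_at R U W u = 1 / 6.
Proof. by case/and3P=> _ uW /eqP e; rewrite /gain_at /gain uW e !light_weights; lra. Qed.

Lemma nbr_sym u v : u \in U -> v \in nbr U u -> u \in nbr U v.
Proof. by rewrite !in_nbr => -> /andP[_]; rewrite adj_sym. Qed.

Lemma nbr_U u v : v \in nbr U u -> v \in U.
Proof. by rewrite in_nbr => /andP[]. Qed.

Hypothesis kinds : forall u, u \in U -> [\/ marked 1 u, marked 2 u, plain 2 u | plain 3 u].

(** The marked vertex becomes isolated and gains [1 / 2]. *)
Lemma delete_nbr_marked1 w u : marked 1 w -> u \in nbr U w -> pk.
Proof.
move=> mw uw; have uU := nbr_U uw.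
have wU : w \in U by case/and3P: mw.
apply: (@packs_delete_light R G U W IH light u [set w]) => //.
  by rewrite sub1set; apply: nbr_sym.
rewrite big_set1 gain_marked1 // cards1.
by case: (kinds uU) => k; rewrite ?(wt_marked1 k) ?(wt_marked2 k) ?(wt_plain2 k) ?(wt_plain3 k);
   case/and3P: k => _ _ /eqP ->; lra.
Qed.

(** The gains are at least [7 / 30 + 1 / 10], which is the weight [1 / 3] of
    [v]. *)
Lemma delete_marked2_plain2 v a : marked 2 v -> plain 2 a -> a \in nbr U v -> pk.
Proof.
move=> mv pa av; have vU : v \in U by case/and3P: mv.
apply: (@packs_delete_light R G U W IH light v [set a]) => //.
  by rewrite sub1set.
rewrite big_set1 gain_plain2 // cards1 wt_marked2 //.
by case/and3P: mv => _ _ /eqP ->; lra.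
Qed.

Lemma delete_between_marked2 v a b : marked 2 v -> marked 2 a -> marked 2 b ->
  nbr U v = [set a; b] -> a != b -> pk.
Proof.
move=> mv ma mb nv ab; have vU : v \in U by case/and3P: mv.
apply: (@packs_delete_light R G U W IH light v [set a; b]); rewrite ?nv //.
rewrite big_setU1 ?inE //= big_set1 !gain_marked2 // wt_marked2 // (card_pair ab).
lra.
Qed.

(** The gains are at least [7 / 30 + 1 / 6 + 1 / 10], which is the weight
    [1 / 2] of [x]. *)
Lemma delete_plain3 x v a : plain 3 x -> plain 2 v -> plain 2 a || marked 2 a ->
  v \in nbr U x -> a \in nbr U x -> v != a -> pk.
Proof.
move=> px pv ka vx ax va; have xU : x \in U by case/and3P: px.
apply: (@packs_delete_light R G U W IH light x [set v; a]) => //.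
  by apply/subsetP => u /set2P[]->.
rewrite big_setU1 ?inE //= big_set1 (card_pair va) (gain_plain2 pv) (wt_plain3 px).
case/and3P: px => _ _ /eqP->.
by case/orP: ka => k; rewrite ?(gain_plain2 k) ?(gain_marked2 k); lra.
Qed.

Hypothesis no_marked1 : forall u, ~ marked 1 u.
Hypothesis no_plain2_marked2 : forall u v, plain 2 u -> marked 2 v -> v \notin nbr U u.

Lemma plain_disjoint2 k l u v : plain k u -> plain l v -> [disjoint [set u; v] & W].
Proof.
move=> /and3P[_ uW _] /and3P[_ vW _]; rewrite disjoints_subset.
by apply/subsetP => x /set2P[]->; rewrite inE.
Qed.

Lemma plain_disjoint3 k l m u v x : plain k u -> plain l v -> plain m x ->
  [disjoint u |: [set v; x] & W].
Proof.
move=> /and3P[_ uW _] /and3P[_ vW _] /and3P[_ xW _]; rewrite disjoints_subset.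
by apply/subsetP => y /setU1P[->|/set2P[]->]; rewrite inE.
Qed.

Lemma wt_le u : u \in U -> w6 u <= 3 / 5.
Proof.
move/kinds => [] k; rewrite ?(wt_marked1 k) ?(wt_marked2 k) ?(wt_plain2 k) ?(wt_plain3 k); lra.
Qed.

Lemma cost_le35 T d : d \in U -> cost T d <= 3 / 5.
Proof. by move=> dU; apply: le_trans (cost_le_wt _ _ _ _ _) (wt_le dU). Qed.

Lemma cost_plain3 T d : plain 3 d -> cost T d <= 1 / 2.
Proof. by move=> pd; rewrite -(wt_plain3 pd) cost_le_wt. Qed.

Lemma cost_plain3_out1 T d a b : plain 3 d ->
  nbr U d :&: closed_nbr T \subset [set a; b] -> cost T d <= 2 / 5.
Proof.
move=> pd s; have := @cost_le R G U W T d _ 2 s; rewrite (wt_plain3 pd) cards2.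
case/and3P: pd => _ _ /eqP ->; move/(_ (ltac:(by case: (_ == _)))); lra.
Qed.

Lemma cost_plain3_out2 T d a : plain 3 d ->
  nbr U d :&: closed_nbr T \subset [set a] -> cost T d <= 3 / 10.
Proof.
move=> pd s; have := @cost_le R G U W T d _ 1 s; rewrite (wt_plain3 pd) cards1.
by case/and3P: pd => _ _ /eqP -> /(_ isT); lra.
Qed.

Lemma indep1 (v : G) : {in [set v] &, forall a b, ~~ adj a b}.
Proof. by move=> a b /set1P-> /set1P->; rewrite adj_irr. Qed.

Lemma indep2 (v x : G) : ~~ adj v x -> {in [set v; x] &, forall a b, ~~ adj a b}.
Proof.
by move=> vx a b /set2P[]-> /set2P[]->; rewrite ?adj_irr // adj_sym.
Qed.

Lemma plain_in k u : plain k u -> u \in U.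
Proof. by case/and3P. Qed.

Lemma plain2_nbr v u : plain 2 v -> u \in nbr U v ->
  exists2 y, y != u & nbr U v = [set u; y].
Proof. by case/and3P => _ _ /eqP e uv; apply: set2_other. Qed.

Lemma adj_nbr v x : x \in U -> adj v x = (x \in nbr U v).
Proof. by rewrite in_nbr => ->. Qed.

Lemma neq_nbr u v : v \in nbr U u -> v != u.
Proof. by apply: contraTneq => ->; rewrite nbr_notin. Qed.

(** Keep the path on the three vertices; with its two further neighbours it
    weighs at most [5 * (3 / 5) = 3]. In a triangle, keep one edge. The pentagon
    shows that nothing is left over here. *)
Lemma three_plain2 u v x : plain 2 u -> plain 2 v -> plain 2 x ->
  nbr U u = [set v; x] -> v != x -> pk.
Proof.
move=> pu pv px nu vx.
have [uU vU xU] := And3 (plain_in pu) (plain_in pv) (plain_in px).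
have vNu : v \in nbr U u by rewrite nu !inE eqxx.
have xNu : x \in nbr U u by rewrite nu !inE eqxx orbT.
have [y yu nv] := plain2_nbr pv (nbr_sym uU vNu).
have [z zu nx] := plain2_nbr px (nbr_sym uU xNu).
have yU : y \in U by apply: (@nbr_U v); rewrite nv !inE eqxx orbT.
have zU : z \in U by apply: (@nbr_U x); rewrite nx !inE eqxx orbT.
have [exy|xy] := eqVneq x y.
  apply: (@packs_star R G U W IH light u [set v] [:: (x, 3 / 5)]) => //.
  - by rewrite sub1set.
  - exact: indep1.
  - exact: plain_disjoint2 pu pv.
  - rewrite closed_nbr_pair nu nv -exy; apply/subsetP => d; rewrite !inE.
    split_eqs d.
  - by move=> p; rewrite inE => /eqP-> /=; split; [apply: cost_le35 | lra].
  rewrite big_set1 cards1 big_seq1 /= (wt_plain2 pu) (wt_plain2 pv); lra.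
have vxN : ~~ adj v x by rewrite adj_nbr // nv !inE negb_or xy neq_nbr.
apply: (@packs_star R G U W IH light u [set v; x] [:: (y, 3 / 5); (z, 3 / 5)]) => //.
- by rewrite nu.
- exact: indep2.
- exact: plain_disjoint3 pu pv px.
- rewrite closed_nbr_triple nu nv nx; apply/subsetP => d; rewrite !inE.
  split_eqs d.
- by move=> p; rewrite !inE => /orP[]/eqP-> /=; split; [apply: cost_le35 | lra | apply: cost_le35 | lra].
rewrite big_setU1 ?inE //= big_set1 (card_pair vx) !big_cons big_nil /=.
rewrite (wt_plain2 pu) (wt_plain2 pv) (wt_plain2 px); lra.
Qed.

(** By [three_plain2] the other neighbours [x] and [y] have degree 3. Keep [u]
    and [v]: if [x] and [y] differ, each of them has a neighbour outside, so the
    balance is [2 * (3 / 5) + 2 * (2 / 5) = 2]. *)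
Lemma adjacent_plain2 u v : plain 2 u -> plain 2 v -> v \in nbr U u -> pk.
Proof.
move=> pu pv vNu.
have [uU vU] := conj (plain_in pu) (plain_in pv).
have uNv := nbr_sym uU vNu.
have [x xv nu] := plain2_nbr pu vNu.
have [y yu nv] := plain2_nbr pv uNv.
have xNu : x \in nbr U u by rewrite nu !inE eqxx orbT.
have yNv : y \in nbr U v by rewrite nv !inE eqxx orbT.
have [xU yU] := conj (nbr_U xNu) (nbr_U yNv).
have px : plain 2 x \/ plain 3 x.
  case: (kinds xU) => k; auto; first by case: (no_marked1 k).
  by have := no_plain2_marked2 pu k; rewrite xNu.
have py : plain 2 y \/ plain 3 y.
  case: (kinds yU) => k; auto; first by case: (no_marked1 k).
  by have := no_plain2_marked2 pv k; rewrite yNv.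
case: px => px; first by apply: (three_plain2 pu pv px nu); rewrite eq_sym.
case: py => py; first by apply: (three_plain2 pv pu py nv); rewrite eq_sym.
have small : closed_nbr [set u; v] \subset [set u; v] :|: [set x; y].
  by rewrite closed_nbr_pair nu nv; apply/subsetP => d; rewrite !inE; split_eqs d.
have [exy|xy] := eqVneq x y.
  apply: (@packs_star R G U W IH light u [set v] [:: (x, 1 / 2)]) => //.
  - by rewrite sub1set.
  - exact: indep1.
  - exact: plain_disjoint2 pu pv.
  - apply: subset_trans small _; rewrite -exy; apply/subsetP => d; rewrite !inE.
    split_eqs d.
  - by move=> p; rewrite inE => /eqP-> /=; split; [apply: cost_plain3 | lra].
  rewrite big_set1 cards1 big_seq1 /= (wt_plain2 pu) (wt_plain2 pv); lra.
have vx : v \notin nbr U x.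
  by apply/negP => /(nbr_sym xU); rewrite nv !inE (negbTE xy) (negbTE (neq_nbr xNu)).
have uy : u \notin nbr U y.
  by apply/negP => /(nbr_sym yU); rewrite nu !inE (negbTE (neq_nbr yNv)) eq_sym (negbTE xy).
apply: (@packs_star R G U W IH light u [set v] [:: (x, 2 / 5); (y, 2 / 5)]) => //.
- by rewrite sub1set.
- exact: indep1.
- exact: plain_disjoint2 pu pv.
- apply: subset_trans small _; apply/subsetP => d; rewrite !inE.
  split_eqs d.
- move=> p; rewrite !inE => /orP[]/eqP-> /=; (split; last lra).
    apply: (@cost_plain3_out1 _ _ u y px); apply/subsetP => d /setIP[dx /(subsetP small)].
    rewrite !inE; case: (d =P v) dx => [->|_ dx]; first by rewrite (negbTE vx).
    by rewrite (negbTE (neq_nbr dx)) ?orbF /=.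
  apply: (@cost_plain3_out1 _ _ v x py); apply/subsetP => d /setIP[dx /(subsetP small)].
  rewrite !inE; case: (d =P u) dx => [->|_ dx]; first by rewrite (negbTE uy).
  by rewrite (negbTE (neq_nbr dx)) ?orbF /=.
by rewrite big_set1 cards1 !big_cons big_nil /= (wt_plain2 pu) (wt_plain2 pv); lra.
Qed.

Hypothesis no_adjacent_plain2 : forall u v, plain 2 u -> plain 2 v -> v \notin nbr U u.
Hypothesis plain3_beside_plain2 : forall x v a, plain 3 x -> plain 2 v ->
  v \in nbr U x -> a \in nbr U x -> a != v -> plain 3 a.

Lemma plain3_nbr2 x u v : plain 3 x -> u \in nbr U x -> v \in nbr U x -> u != v ->
  exists z, [/\ z != u, z != v & nbr U x = u |: [set v; z]].
Proof. by case/and3P => _ _ /eqP e uN vN uv; apply: set3_other. Qed.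

Lemma plain3_nbr1 x u : plain 3 x -> u \in nbr U x ->
  exists y z, [/\ y != u, z != u, z != y & nbr U x = u |: [set y; z]].
Proof. by case/and3P => _ _ /eqP e uN; apply: set3_others. Qed.

(* Shows that the neighbours of a vertex in a closed neighbourhood, bounded by
   the explicit set of [small], are among the vertices listed in the goal: every
   other candidate is the vertex itself or is refuted by a hypothesis. *)
Ltac only_nbrs d dN small :=
  apply/subsetP => d /setIP[dN /(subsetP small)]; rewrite !inE;
  repeat match goal with |- context [d == ?a] =>
    let e := fresh "e" in
    case: (eqVneq d a) => [e|_];
    [first [ by rewrite e ?eqxx ?orbT
           | by move: dN; rewrite e (negbTE (nbr_notin _ _))
           | by exfalso; move: dN; rewrite e; apply/negP; assumption ] | ]
  end; by [].

(** Keep [v] and [x]; the third neighbour [z] of [x] is not adjacent to [v], so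
    it has a neighbour outside, and the balance is
    [3 / 5 + 1 / 2 + 1 / 2 + 2 / 5 = 2]. *)
Lemma plain2_triangle v x y : plain 2 v -> plain 3 x -> plain 3 y ->
  nbr U v = [set x; y] -> y != x -> y \in nbr U x -> pk.
Proof.
move=> pv px py nv yx yNx.
have [vU xU yU] := And3 (plain_in pv) (plain_in px) (plain_in py).
have xNv : x \in nbr U v by rewrite nv !inE eqxx.
have yNv : y \in nbr U v by rewrite nv !inE eqxx orbT.
have [vNx vNy] := conj (nbr_sym vU xNv) (nbr_sym vU yNv).
have [|z [zv zy nx]] := plain3_nbr2 px vNx yNx; first by rewrite eq_sym neq_nbr.
have zNx : z \in nbr U x by rewrite nx !inE eqxx !orbT.
have pz := plain3_beside_plain2 px pv vNx zNx zv.
have vz : v \notin nbr U z.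
  apply/negP => /(nbr_sym (plain_in pz)).
  by rewrite nv !inE (negbTE zy) (negbTE (neq_nbr zNx)).
have small : closed_nbr [set v; x] \subset [set v; x] :|: [set y; z].
  by rewrite closed_nbr_pair nv nx; apply/subsetP => d; rewrite !inE; split_eqs d.
apply: (@packs_star R G U W IH light v [set x] [:: (y, 1 / 2); (z, 2 / 5)]) => //.
- by rewrite sub1set.
- exact: indep1.
- exact: plain_disjoint2 pv px.
- apply: subset_trans small _; apply/subsetP => d; rewrite !inE.
  split_eqs d.
- move=> p; rewrite !inE => /orP[]/eqP-> /=; (split; last lra).
    exact: cost_plain3.
  by apply: (@cost_plain3_out1 _ _ x y pz); only_nbrs d dN small.
by rewrite big_set1 cards1 !big_cons big_nil /= (wt_plain2 pv) (wt_plain3 px); lra.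
Qed.

(** Keep the path [x], [v], [y]. Its other neighbours are [z] and the third
    neighbours [x'] and [y'] of [x] and [y]. If [x'] and [y'] differ, at least one
    of the three has a neighbour outside: an edge from [x'] to [z] exhausts the
    neighbours of [z], and then [y'] is adjacent to neither [x] nor [z];
    otherwise [x'] itself is adjacent to neither [y] nor [z]. The balance is
    [8 / 5 + 1 / 2 + 1 / 2 + 2 / 5 = 3]. *)
Lemma plain2_square v x y z : plain 2 v -> plain 3 x -> plain 3 y ->
  nbr U v = [set x; y] -> y != x -> y \notin nbr U x ->
  z \in nbr U x -> z \in nbr U y -> z != v -> pk.
Proof.
move=> pv px py nv yx yNx zNx zNy zv.
have [vU xU yU] := And3 (plain_in pv) (plain_in px) (plain_in py).
have xNv : x \in nbr U v by rewrite nv !inE eqxx.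
have yNv : y \in nbr U v by rewrite nv !inE eqxx orbT.
have [vNx vNy] := conj (nbr_sym vU xNv) (nbr_sym vU yNv).
have pz := plain3_beside_plain2 px pv vNx zNx zv.
have [|x' [xv' xz' nx]] := plain3_nbr2 px vNx zNx; first by rewrite eq_sym.
have [|y' [yv' yz' ny]] := plain3_nbr2 py vNy zNy; first by rewrite eq_sym.
have xNx' : x' \in nbr U x by rewrite nx !inE eqxx !orbT.
have yNy' : y' \in nbr U y by rewrite ny !inE eqxx !orbT.
have px' := plain3_beside_plain2 px pv vNx xNx' xv'.
have py' := plain3_beside_plain2 py pv vNy yNy' yv'.
have yNx2 : x \notin nbr U y by apply: contraNN yNx; apply: nbr_sym.
have xy' : x' != y by apply: contraNneq yNx => <-.
have yx' : y' != x by apply: contraNneq yNx2 => <-.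
have small : closed_nbr (v |: [set x; y]) \subset (v |: [set x; y]) :|: (z |: [set x'; y']).
  by rewrite closed_nbr_triple nv nx ny; apply/subsetP => d; rewrite !inE; split_eqs d.
have star s : v |: [set x; y] :|: (z |: [set x'; y']) \subset
      v |: [set x; y] :|: [set d in unzip1 s] ->
    {in s, forall p, cost (v |: [set x; y]) p.1 <= p.2 /\ 0 <= p.2} ->
    \sum_(p <- s) p.2 <= 7 / 5 -> pk.
  move=> cs ps ss; apply: (@packs_star R G U W IH light v [set x; y] s) => //.
  - by rewrite nv.
  - by apply: indep2; rewrite adj_nbr.
  - exact: plain_disjoint3 pv px py.
  - exact: subset_trans small cs.
  rewrite big_setU1 ?inE //= 1?eq_sym // big_set1 card_pair 1?eq_sym //.
  rewrite (wt_plain2 pv) (wt_plain3 px) (wt_plain3 py); lra.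
have [exy|xNy'] := eqVneq x' y'.
  apply: (star [:: (z, 1 / 2); (x', 1 / 2)]).
  - by rewrite -exy; apply/subsetP => d; rewrite !inE; split_eqs d.
  - by move=> p; rewrite !inE => /orP[]/eqP->/=; split; try lra; apply: cost_plain3.
  by rewrite !big_cons big_nil /=; lra.
have vx' : v \notin nbr U x'.
  by apply/negP => /(nbr_sym (plain_in px')); rewrite nv !inE (negbTE xy') (negbTE (neq_nbr xNx')).
have vy' : v \notin nbr U y'.
  by apply/negP => /(nbr_sym (plain_in py')); rewrite nv !inE (negbTE yx') (negbTE (neq_nbr yNy')).
have [x'z|x'z] := boolP (x' \in nbr U z).
  have [] := @plain3_nbr2 z x y pz _ _ _; rewrite ?(nbr_sym _ zNx) ?(nbr_sym _ zNy) // 1?eq_sym //.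
  move=> t [tx ty nz].
  have et : t = x'.
    by move: x'z; rewrite nz !inE (negbTE (neq_nbr xNx')) (negbTE xy') => /eqP.
  have xy2 : x \notin nbr U y'.
    by apply/negP => /(nbr_sym (plain_in py')); rewrite nx !inE (negbTE yv') (negbTE yz') eq_sym (negbTE xNy').
  have zy2 : z \notin nbr U y'.
    apply/negP => /(nbr_sym (plain_in py')).
    by rewrite nz et !inE (negbTE yx') (negbTE (neq_nbr yNy')) eq_sym (negbTE xNy').
  apply: (star [:: (z, 1 / 2); (x', 1 / 2); (y', 2 / 5)]).
  - by apply/subsetP => d; rewrite !inE; split_eqs d.
  - move=> p; rewrite !inE => /or3P[]/eqP->/=; (split; last lra); try exact: cost_plain3.
    by apply: (@cost_plain3_out1 _ _ y x' py'); only_nbrs d dN small.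
  by rewrite !big_cons big_nil /=; lra.
have yx2 : y \notin nbr U x'.
  by apply/negP => /(nbr_sym (plain_in px')); rewrite ny !inE (negbTE xv') (negbTE xz') (negbTE xNy').
have zx2 : z \notin nbr U x'.
  by apply: contraNN x'z; apply: (nbr_sym (plain_in px')).
apply: (star [:: (z, 1 / 2); (x', 2 / 5); (y', 1 / 2)]).
- by apply/subsetP => d; rewrite !inE; split_eqs d.
- move=> p; rewrite !inE => /or3P[]/eqP->/=; (split; last lra); try exact: cost_plain3.
  by apply: (@cost_plain3_out1 _ _ x y' px'); only_nbrs d dN small.
by rewrite !big_cons big_nil /=; lra.
Qed.

(** Both neighbours [x] and [y] of [v] have degree 3, and after the two lemmas
    above they are not adjacent and have only [v] in common. If the other
    neighbours [a] and [b] of [x] are not adjacent, keeping [v] and [x] leaves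
    [y], [a] and [b] with two neighbours outside each, and
    [3 / 5 + 1 / 2 + 3 * (3 / 10) = 2]. If they are adjacent, keep the path [v],
    [x], [a] and delete [y], [b] and the third neighbour [z] of [a]. *)
Lemma plain2_packs v : plain 2 v -> pk.
Proof.
move=> pv; have vU := plain_in pv.
have plain3_nbr u : u \in nbr U v -> plain 3 u.
  move=> uN; case: (kinds (nbr_U uN)) => k //; first by case: (no_marked1 k).
    by have := no_plain2_marked2 pv k; rewrite uN.
  by have := no_adjacent_plain2 pv k; rewrite uN.
have /card_gt0P[x xNv] : (0 < #|nbr U v|)%N by case/and3P: pv => _ _ /eqP ->.
have [y yx nv] := plain2_nbr pv xNv.
have yNv : y \in nbr U v by rewrite nv !inE eqxx orbT.
have [px py] := conj (plain3_nbr x xNv) (plain3_nbr y yNv).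
have [xU yU] := conj (plain_in px) (plain_in py).
have [yNx|yNx] := boolP (y \in nbr U x); first exact: (plain2_triangle pv px py nv).
have [vNx vNy] := conj (nbr_sym vU xNv) (nbr_sym vU yNv).
have xNy : x \notin nbr U y by apply: contraNN yNx; apply: nbr_sym.
have [common|nocommon] := boolP [exists z, [&& z \in nbr U x, z \in nbr U y & z != v]].
  by case/existsP: common => z /and3P[zx zy zv]; apply: (plain2_square pv px py nv yx yNx zx zy zv).
have no_common z : z \in nbr U x -> z != v -> z \notin nbr U y.
  move=> zx zv; apply: contra nocommon => zy; apply/existsP; exists z.
  by rewrite zx zy zv.
have [a [b [av bv ba nx]]] := plain3_nbr1 px vNx.
have aNx : a \in nbr U x by rewrite nx !inE eqxx !orbT.
have bNx : b \in nbr U x by rewrite nx !inE eqxx !orbT.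
have pa := plain3_beside_plain2 px pv vNx aNx av.
have pb := plain3_beside_plain2 px pv vNx bNx bv.
have [aU bU] := conj (plain_in pa) (plain_in pb).
have [aNy bNy] := conj (no_common a aNx av) (no_common b bNx bv).
have [yNa yNb] : y \notin nbr U a /\ y \notin nbr U b.
  by split; [apply: contraNN aNy | apply: contraNN bNy]; apply: nbr_sym.
have ay : a != y by apply: contraNneq yNx => <-.
have by' : b != y by apply: contraNneq yNx => <-.
have vNa : v \notin nbr U a.
  by apply/negP => /(nbr_sym aU); rewrite nv !inE (negbTE ay) (negbTE (neq_nbr aNx)).
have vNb : v \notin nbr U b.
  by apply/negP => /(nbr_sym bU); rewrite nv !inE (negbTE by') (negbTE (neq_nbr bNx)).
have [bNa|bNa] := boolP (b \in nbr U a); last first.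
  have aNb : a \notin nbr U b by apply: contraNN bNa; apply: nbr_sym.
  have small : closed_nbr [set v; x] \subset [set v; x] :|: (y |: [set a; b]).
    by rewrite closed_nbr_pair nv nx; apply/subsetP => d; rewrite !inE; split_eqs d.
  apply: (@packs_star R G U W IH light v [set x] [:: (y, 3 / 10); (a, 3 / 10); (b, 3 / 10)]) => //.
  - by rewrite sub1set.
  - exact: indep1.
  - exact: plain_disjoint2 pv px.
  - apply: subset_trans small _; apply/subsetP => d; rewrite !inE.
    split_eqs d.
  - move=> p; rewrite !inE => /or3P[]/eqP-> /=; (split; last lra).
    + by apply: (@cost_plain3_out2 _ _ v py); only_nbrs d dN small.
    + by apply: (@cost_plain3_out2 _ _ x pa); only_nbrs d dN small.
    + by apply: (@cost_plain3_out2 _ _ x pb); only_nbrs d dN small.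
  by rewrite big_set1 cards1 !big_cons big_nil /= (wt_plain2 pv) (wt_plain3 px); lra.
have xNa := nbr_sym xU aNx.
have [|z [zx zb na]] := plain3_nbr2 pa xNa bNa; first by rewrite eq_sym neq_nbr.
have zNa : z \in nbr U a by rewrite na !inE eqxx !orbT.
have zU := nbr_U zNa.
have zv : z != v by apply: contraNneq vNa => <-.
have small : closed_nbr (x |: [set v; a]) \subset (x |: [set v; a]) :|: (y |: [set b; z]).
  by rewrite closed_nbr_triple nv nx na; apply/subsetP => d; rewrite !inE; split_eqs d.
have star ky kz : cost (x |: [set v; a]) y <= ky -> cost (x |: [set v; a]) z <= kz ->
    0 <= ky -> 0 <= kz -> ky + kz <= 9 / 10 -> pk.
  move=> cy cz ky0 kz0 sum.
  apply: (@packs_star R G U W IH light x [set v; a] [:: (y, ky); (b, 1 / 2); (z, kz)]) => //.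
  - by apply/subsetP => d /set2P[]->.
  - by apply: indep2; rewrite adj_sym adj_nbr.
  - exact: plain_disjoint3 px pv pa.
  - apply: subset_trans small _; apply/subsetP => d; rewrite !inE.
    split_eqs d.
  - move=> p; rewrite !inE => /or3P[]/eqP-> /=; split=> //; last lra.
    exact: cost_plain3.
  rewrite big_setU1 ?inE //= 1?eq_sym // big_set1 card_pair 1?eq_sym // !big_cons big_nil /=.
  rewrite (wt_plain2 pv) (wt_plain3 px) (wt_plain3 pa); lra.
(* [z] may weigh 3 / 5 if it has degree 2, but then it is not adjacent to [y]. *)
have [pz|npz] := boolP (plain 2 z).
  have zNy : z \notin nbr U y.
    apply/negP => zNy; have /and3P[_ _ /eqP z3] := plain3_beside_plain2 py pv vNy zNy zv.
    by case/and3P: pz => _ _; rewrite z3.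
  apply: (star (3 / 10) (3 / 5)); try lra; last exact: cost_le35.
  by apply: (@cost_plain3_out2 _ _ v py); only_nbrs d dN small.
apply: (star (2 / 5) (1 / 2)); try lra.
  by apply: (@cost_plain3_out1 _ _ v z py); only_nbrs d dN small.
apply: le_trans (cost_le_wt _ _ _ _ _) _.
case: (kinds zU) => k; rewrite ?(wt_marked1 k) ?(wt_marked2 k) ?(wt_plain3 k); try lra.
by rewrite k in npz.
Qed.

End Subcubic.

(** * Halving the remaining graph by a maximum cut *)

(** A cut of maximum weight cannot be improved by moving a single vertex to the
    other side. *)
Lemma local_max_cut (T : finType) (U : {set T}) (e : T -> T -> nat) :
  (forall x y, e x y = e y x) -> (forall x, e x x = 0%N) ->
  exists c : T -> bool, forall x, x \in U ->
    (\sum_(y in U | c y == c x) e x y <= \sum_(y in U | c y != c x) e x y)%N.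
Proof.
move=> eC e0.
pose q (c : {ffun T -> bool}) := (\sum_(u in U) \sum_(v in U | c v == c u) e u v)%N.
case: (@arg_minnP _ [ffun=> true] xpredT q isT) => c _ cmin.
exists c => x xU.
pose rest (c : {ffun T -> bool}) :=
  (\sum_(u in U :\ x) \sum_(v in U :\ x | c v == c u) e u v)%N.
have split_q (f : {ffun T -> bool}) :
    q f = (rest f + (\sum_(v in U | f v == f x) e x v).*2)%N.
  have inner : (\sum_(v in U | f v == f x) e x v =
                \sum_(v in U :\ x | f v == f x) e x v)%N.
    rewrite (bigD1 x) /= ?xU ?eqxx // e0; apply: eq_bigl => v.
    by rewrite !inE; case: (v == x); case: (v \in U); rewrite ?andbF ?andbT.
  rewrite /q (big_setD1 x) //= inner -addnn addnA addnC; congr (_ + _)%N.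
  rewrite /rest [X in (_ + X)%N]big_mkcondr -big_split /=; apply: eq_bigr => u /setD1P[ux uU].
  rewrite !big_mkcondr (big_setD1 x) //= addnC; congr (_ + _)%N.
  by rewrite eq_sym eC.
pose c' := [ffun y => if y == x then ~~ c x else c y].
have := cmin c' isT; rewrite !split_q.
have -> : rest c' = rest c.
  apply: eq_bigr => u /setD1P[ux _]; apply: eq_bigl => v; rewrite !ffunE (negbTE ux).
  by rewrite !inE; case: (v == x).
rewrite leq_add2l leq_double => h; apply: leq_trans h _.
rewrite leq_eqVlt; apply/orP; left; apply/eqP.
rewrite (bigD1 x) /= ?xU ?eqxx // e0 add0n.
apply: eq_bigl => v; rewrite !ffunE eqxx; case: (eqVneq v x) => [->|_].
  by rewrite !eqxx !andbF.
by rewrite andbT; case: (c v); case: (c x).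
Qed.

Section CutStep.
Variables (R : realType) (G : sgraph).
Variables (U W : {set G}).
Local Notation w6 := (wt (1 / 6 : R) U W).
Local Notation plain := (plain U W).
Local Notation marked := (marked U W).
Hypothesis kinds : forall u, u \in U -> marked 2%N u \/ plain 3%N u.
Hypothesis no_two : forall u a b, marked 2%N u -> marked 2%N a -> marked 2%N b ->
  a != b -> nbr U u != [set a; b].

(** Give the edges between two marked vertices weight 3 and all others weight 2.
    In a maximum cut an unmarked vertex, of total weight 6, has at most one
    neighbour on its own side. No marked vertex has a marked neighbour on its
    own side, since its other neighbour is unmarked and 3 exceeds 2. So both
    sides are star sets, and the larger one has at least half of the vertices,
    whose weights are [1 / 2] and [1 / 3]. *)
Lemma packs_max_cut : packs (1 / 6 : R) U W.
Proof.
(* Twice the edge weights 1 and 3 / 2, to stay in the natural numbers. *)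
pose e u v : nat := if adj u v then (if (u \in W) && (v \in W) then 3 else 2)%N else 0%N.
have [||c cP] := @local_max_cut G U e.
- by move=> u v; rewrite /e adj_sym andbC.
- by move=> u; rewrite /e adj_irr.
pose A b := [set u in U | c u == b].
have AU b : A b \subset U by apply/subsetP => u /[!inE]/andP[].
have sum_nbr (P : pred G) u : (\sum_(v in U | P v) e u v = \sum_(v in nbr U u | P v) e u v)%N.
  rewrite (bigID (adj u)) /= [X in (_ + X)%N]big1 ?addn0.
    by apply: eq_bigl => v; rewrite in_nbr andbAC.
  by move=> v /andP[_ /negbTE uv]; rewrite /e uv.
have card_sum (P : pred G) u k : (forall v, v \in nbr U u -> P v -> e u v = k) ->
    (\sum_(v in nbr U u | P v) e u v = #|[set v in nbr U u | P v]| * k)%N.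
  move=> h; rewrite -sum_nat_const; apply: eq_big => v; first by rewrite inE.
  by case/andP=> *; apply: h.
have sA b : star_set W (A b).
  apply/star_setP.
  have one u : u \in A b -> u \notin W -> (#|nbr (A b) u| + (u \in W) <= 1)%N.
    move=> uA uW; have /[!inE]/andP[uU /eqP cu] := uA.
    have /and3P[_ _ /eqP n3] : plain 3%N u.
      by case: (kinds uU) => // /and3P[_]; rewrite (negbTE uW).
    have := cP u uU; rewrite !sum_nbr !(@card_sum _ _ 2%N); last 2 first.
    - by move=> v /[!in_nbr]/andP[_ uv] _; rewrite /e uv (negbTE uW).
    - by move=> v /[!in_nbr]/andP[_ uv] _; rewrite /e uv (negbTE uW).
    have -> : [set v in nbr U u | c v == c u] = nbr (A b) u.
      by apply/setP => v; rewrite !inE cu andbAC.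
    have -> : [set v in nbr U u | c v != c u] = nbr U u :\: nbr (A b) u.
      by apply/setP => v; rewrite !inE cu; case: (v \in U); case: (adj u v); case: (c v == b).
    rewrite cardsD n3 (_ : nbr U u :&: nbr (A b) u = nbr (A b) u).
      by rewrite (negbTE uW) addn0; lia.
    by apply/setIidPr/subsetP => v /[!inE]/andP[/andP[-> _] ->].
  move=> u v uA vA uv.
  case uW: (u \in W); last by left; rewrite -uW; apply: one; rewrite ?uW.
  case vW: (v \in W); last by right; rewrite -vW; apply: one; rewrite ?vW.
  have /[!inE]/andP[uU /eqP cu] := uA.
  have /[!inE]/andP[vU /eqP cv] := vA.
  have mark x : x \in U -> x \in W -> marked 2%N x.
    by move=> xU xW; case: (kinds xU) => // /and3P[_]; rewrite xW.
  have [mu mv] := conj (mark u uU uW) (mark v vU vW).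
  have vN : v \in nbr U u by rewrite in_nbr vU.
  case/and3P: (mu) => _ _ /eqP n2.
  have [a av nu] := set2_other vN n2.
  have aN : a \in nbr U u by rewrite nu !inE eqxx orbT.
  have aU := nbr_U aN.
  have aW : a \notin W.
    apply/negP => aW; have := no_two mu mv (mark a aU aW).
    by rewrite eq_sym av nu eqxx => /(_ isT).
  exfalso; have := cP u uU; rewrite leqNgt => /negP; apply.
  rewrite !sum_nbr; apply: (@leq_ltn_trans 2%N).
    rewrite (@card_sum _ _ 2%N).
      rewrite -[leqRHS]mul1n leq_mul2r /= -(cards1 a) subset_leq_card //.
      apply/subsetP => x; rewrite inE nu !inE => /andP[/orP[]/eqP->//].
      by rewrite cu cv eqxx.
    move=> x; rewrite nu => /set2P[]->; first by rewrite cu cv eqxx.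
    by move: aN; rewrite in_nbr /e => /andP[_ ->]; rewrite (negbTE aW) andbF.
  by rewrite (bigD1 v) /= ?vN ?cu ?cv ?eqxx // /e uv uW vW.
have total : (#|A true| + #|A false| = #|U|)%N.
  rewrite -(cardsID (A true) U); congr (_ + _)%N; apply: eq_card => u; rewrite !inE.
    by rewrite andbA andbb.
  by case: (u \in U); case: (c u).
have le_half : \sum_(u in U) w6 u <= #|U|%:R / 2.
  rewrite -sumr_const mulr_suml; apply: ler_sum => u uU.
  by case: (kinds uU) => k; rewrite ?(wt_marked2 _ k) ?(wt_plain3 _ k); lra.
have [b large] : exists b, (#|U| <= #|A b|.*2)%N.
  case: (leqP #|A false| #|A true|) => h; [exists true | exists false]; lia.
exists (A b); split=> //; apply: le_trans le_half _.
by rewrite ler_pdivrMr // -natrM ler_nat muln2.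
Qed.
End CutStep.

(** * The lower bound *)

Section Main.
Variables (R : realType) (G : sgraph).

Lemma plain_marked_cases (U W : {set G}) u : u \in U -> ~~ heavy (u \in W) #|nbr U u| ->
  #|nbr U u| != 0%N -> ~~ plain U W 1 u ->
  [\/ marked U W 1 u, marked U W 2 u, plain U W 2 u | plain U W 3 u].
Proof.
rewrite /marked /plain => -> /=; case: (u \in W) => /=;
  case: #|nbr U u| => [|[|[|[|d]]]] //= _ _ _;
  by [constructor 1 | constructor 2 | constructor 3 | constructor 4].
Qed.

Lemma packs_sixth (U W : {set G}) : packs (1 / 6 : R) U W.
Proof.
have [n] := ubnP #|U|; elim: n U W => // n IHn U W; rewrite ltnS => Un.
have IH (U' W' : {set G}) : (#|U'| < #|U|)%N -> packs (1 / 6 : R) U' W'.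
  by move=> lt; apply: IHn; apply: leq_trans lt Un.
have IH1 u W' : u \in U -> packs (1 / 6 : R) (U :\ u) W'.
  by move=> uU; apply: IH; rewrite [ltnRHS](cardsD1 u) uU.
apply: contrapT => npk.
have light u : u \in U -> ~~ heavy (u \in W) #|nbr U u|.
  move=> uU; apply/negP => hu; apply: npk; apply: packs_heavy uU hu => v vU.
  exact: IH1.
have kinds u : u \in U -> [\/ marked U W 1 u, marked U W 2 u, plain U W 2 u | plain U W 3 u].
  move=> uU; apply: plain_marked_cases => //; first exact: light.
    apply/negP => /eqP/cards0_eq n0; apply: npk.
    exact: packs_isolated uU n0 (IH1 _ _ uU).
  apply/negP => /and3P[_ uW /cards1P[v nu]]; apply: npk.
  by apply: packs_leaf uU uW nu (IH1 _ _ uU); lra.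
have no_marked1 u : ~ marked U W 1 u.
  move=> mu; case/and3P: (mu) => uU _ /eqP n1.
  have /card_gt0P[v vN] : (0 < #|nbr U u|)%N by rewrite n1.
  exact: npk (delete_nbr_marked1 IH light kinds mu vN).
have no_mix u v : plain U W 2 u -> marked U W 2 v -> v \notin nbr U u.
  move=> pu mv; apply/negP => vN; apply: npk.
  by apply: (delete_marked2_plain2 IH light mv pu); apply: nbr_sym vN; case/and3P: pu.
have no_adj u v : plain U W 2 u -> plain U W 2 v -> v \notin nbr U u.
  move=> pu pv; apply/negP => vN; apply: npk.
  exact: (adjacent_plain2 IH light kinds no_marked1 no_mix pu pv vN).
have beside x v a : plain U W 3 x -> plain U W 2 v ->
    v \in nbr U x -> a \in nbr U x -> a != v -> plain U W 3 a.
  move=> px pv vN aN av; have del := @delete_plain3 R G U W IH light x v a px pv.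
  case: (kinds a (nbr_U aN)) => // k; first by case: (no_marked1 a).
    by case: npk; apply: del; rewrite // ?k ?orbT // eq_sym.
  by case: npk; apply: del; rewrite // ?k ?orbT // eq_sym.
have no_plain2 v : ~ plain U W 2 v.
  by move=> pv; apply: npk; apply: (plain2_packs IH light kinds no_marked1 no_mix no_adj beside pv).
apply: (npk); apply: packs_max_cut => [u uU|u a b mu ma mb ab].
  case: (kinds u uU) => k; [by case: (no_marked1 u) | by left | by case: (no_plain2 u) | by right].
by apply/eqP => nu; apply: npk; apply: (delete_between_marked2 IH light mu ma mb nu ab).
Qed.

(** Strip the unmarked leaves first. Afterwards no unmarked vertex has degree 1,
    the only degree at which [f_eps] exceeds its value for [eps = 1 / 6]. *)
Lemma packs_eps (eps : R) (U W : {set G}) : 0 <= eps <= 1 / 6 -> packs eps U W.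
Proof.
move=> e01; have e0 : 0 <= eps by case/andP: e01.
have [n] := ubnP #|U|; elim: n U W => // n IHn U W; rewrite ltnS => Un.
have [/existsP[u /and3P[uU uW /cards1P[v nu]]]|no_leaf] :=
    boolP [exists u, [&& u \in U, u \notin W & #|nbr U u| == 1%N]].
  apply: (packs_leaf e0 uU uW nu); apply: IHn.
  by apply: leq_trans Un; rewrite [ltnRHS](cardsD1 u) uU.
have [A [AU sA le]] := packs_sixth U W.
exists A; split=> //; apply: le_trans le; apply: ler_sum => u uU.
rewrite /wt /weight; case: ifP => // uW; apply: f_eps_le_sixth => //.
by apply: contraNneq no_leaf => n1; apply/existsP; exists u; rewrite uU uW n1.
Qed.

End Main.

Section StarForest.
Variable G : sgraph.
Implicit Types (S : {set G}).

(** On a cycle any two consecutive vertices have degree at least 2. In a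
    component, a vertex of maximum degree is a centre: a neighbour with a second
    neighbour would have degree at least 2, and so would the centre. *)
Lemma star_set_star_forest S : star_set set0 S -> star_forest (induced S).
Proof.
move=> /star_setP sS; set H := induced S.
have deg_nbr (a : H) : #|nbr S (val a)| = deg a.
  rewrite /deg -(card_imset _ val_inj); apply: eq_card => w; rewrite in_nbr.
  apply/andP/imsetP => [[wS aw]|[b /[!inE] ab ->]].
    by exists (Sub w wS); rewrite ?inE //= /induced_adj SubK.
  by split; [exact: valP | exact: ab].
have leaf (a b : H) : adj a b -> (deg a <= 1)%N \/ (deg b <= 1)%N.
  move=> ab; have := sS _ _ (valP a) (valP b) ab.
  by rewrite !inE !addn0 !deg_nbr.
have deg2 (a b c : H) : adj a b -> adj a c -> b != c -> (1 < deg a)%N.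
  move=> ab ac bc; rewrite /deg -(_ : #|[set b; c]| = 2%N); last by rewrite cards2 bc.
  by apply: subset_leq_card; apply/subsetP => x /set2P[]->; rewrite inE.
have walk (a b c d : H) : adj a b -> adj b c -> adj c d -> a != c -> b != d -> False.
  move=> ab bc cd ac bd; have ba : adj b a by rewrite adj_sym.
  have cb : adj c b by rewrite adj_sym.
  have hb := deg2 _ _ _ ba bc ac; have hc := deg2 _ _ _ cb cd bd.
  by case: (leaf b c bc); rewrite leqNgt ?hb ?hc.
split=> [s|x].
  case: s => [|a [|b [|c s]]] //= /andP[+ us]; rewrite /= rcons_path => /and3P[ab bc].
  case/andP=> _ la; exfalso.
  case/and3P: us => aN bN _.
  apply: (walk (last c s) a b c) => //.
    by apply: contraNneq bN => <-; rewrite mem_last.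
  by apply: contraNneq aN => ->; rewrite !inE eqxx orbT.
pose K := component x.
have xK : x \in K by rewrite inE connect0.
pose c := [arg max_(y > x in K) deg y].
have [cK cmax] : c \in K /\ forall y, y \in K -> (deg y <= deg c)%N.
  by rewrite /c; case: arg_maxnP => // i iK h; split=> // y yK; apply: h.
have csym : connect_sym (@adj H) by apply: sym_connect_sym; apply: adj_sym.
have closedN : closed (@adj H) [pred y | (y == c) || adj c y].
  apply: (intro_closed csym) => z w zw /predU1P[zc|cz]; apply/predU1P.
    by right; rewrite -zc.
  case: (eqVneq w c) => [|wc]; [by left | exfalso].
  have zK : z \in K by move: cK; rewrite !inE => xc; apply: connect_trans xc (connect1 cz).
  have zc : adj z c by rewrite adj_sym.
  have z2 : (1 < deg z)%N by apply: deg2 zc zw _; rewrite eq_sym.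
  have := leq_trans z2 (cmax z zK); move: z2.
  by case: (leaf z c zc); rewrite leqNgt => /negbTE->.
have near y : y \in K -> (y == c) || adj c y.
  move: cK; rewrite !inE csym => cx xy.
  have := closed_connect closedN (connect_trans cx xy).
  by rewrite !inE eqxx /= => <-.
have yz_c (a b : H) : a \in K -> b \in K -> adj a b -> (a == c) || (b == c).
  move=> aK bK ab; case: (eqVneq a c) => //= ac; apply: contraT => bc.
  have [+ +] := conj (near a aK) (near b bK).
  rewrite (negbTE ac) (negbTE bc) /= => ca cb; exfalso.
  have ac' : adj a c by rewrite adj_sym.
  have ab' : a != b by apply: contraTneq ab => ->; rewrite adj_irr.
  by apply: (walk b c a b) => //; [rewrite adj_sym | rewrite eq_sym | rewrite eq_sym].
suff star (a b : H) : a \in K -> b \in K -> adj a b = (a != b) && ((a == c) || (b == c)).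
  by exists (Sub c cK) => y z; rewrite -!(inj_eq val_inj); apply: star; apply: valP.
move=> aK bK; apply/idP/andP => [ab|[ab /orP[]/eqP e]].
- by split; [apply: contraTneq ab => ->; rewrite adj_irr | apply: yz_c].
- by have := near b bK; rewrite -e eq_sym (negbTE ab).
- by have := near a aK; rewrite -e (negbTE ab) adj_sym.
Qed.

Lemma lower_bound_eps (R : realType) (eps : R) : 0 <= eps <= 1 / 6 ->
  \sum_(v : G) f_eps eps (deg v) <= (alpha star_forest G)%:R.
Proof.
move=> e01; have [A [_ sA le]] := packs_eps [set: G] set0 e01.
have sum_eq : \sum_(v in [set: G]) wt eps [set: G] set0 v = \sum_(v : G) f_eps eps (deg v).
  by apply: eq_big => [v|v _]; rewrite ?inE // /wt /weight inE nbrT.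
rewrite sum_eq in le; apply: le_trans le _; rewrite ler_nat.
by apply: (@leq_bigmax_cond _ _ (fun S : {set G} => #|S|)); apply/asboolP/star_set_star_forest.
Qed.

End StarForest.

(** * Graphs that limit every lower bound *)

(** A star contains neither a path with three edges nor a triangle; the latter
    is the case [a = d]. *)
Lemma star_forest_no_walk (G : sgraph) (S : {set G}) (a b c d : G) :
  star_forest (induced S) -> a \in S -> b \in S -> c \in S -> d \in S ->
  adj a b -> adj b c -> adj c d -> a != c -> b != d -> False.
Proof.
move=> [_ stars] aS bS cS dS ab bc cd ac bd.
pose H := induced S; pose a' : H := Sub a aS; pose b' : H := Sub b bS.
pose c' : H := Sub c cS; pose d' : H := Sub d dS.
have [z zP] := stars a'.
have step (u v : H) : u \in component a' -> adj (val u) (val v) -> v \in component a'.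
  by rewrite !inE => au uv; apply: connect_trans au (connect1 _).
have ka : a' \in component a' by rewrite inE connect0.
have kb : b' \in component a' by apply: step ka _.
have kc : c' \in component a' by apply: step kb _.
have kd : d' \in component a' by apply: step kc _.
have center (u v : H) : u \in component a' -> v \in component a' ->
    adj (val u) (val v) -> u = val z \/ v = val z.
  move=> ku kv uv; have := zP (Sub u ku) (Sub v kv).
  have -> : adj (Sub u ku : induced (component a')) (Sub v kv) = true by exact: uv.
  by move/esym/andP => [_ /orP[]/eqP <-]; [left | right].
have neq (u v : H) : u = val z -> v = val z -> val u = val v by move=> -> ->.
case: (center b' c' kb kc bc) => e.
  case: (center c' d' kc kd cd) => e'.
    by move: bc; rewrite [b](neq b' c' e e') adj_irr.
  by move: bd; rewrite [b](neq b' d' e e') eqxx.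
case: (center a' b' ka kb ab) => e'.
  by move: ac; rewrite [a](neq a' c' e' e) eqxx.
by move: bc; rewrite [b](neq b' c' e' e) adj_irr.
Qed.

Lemma alpha_le (C : sgraph -> Prop) (G : sgraph) k :
  (forall S : {set G}, C (induced S) -> (#|S| <= k)%N) -> (alpha C G <= k)%N.
Proof. by move=> h; apply/bigmax_leqP => S /asboolP; apply: h. Qed.

Lemma star_forest_triangle (G : sgraph) (S : {set G}) (a b c : G) :
  star_forest (induced S) -> a \in S -> b \in S -> c \in S ->
  adj a b -> adj b c -> adj c a -> False.
Proof.
move=> sf aS bS cS ab bc ca; apply: (star_forest_no_walk sf aS bS cS aS) => //.
  by apply: contraTneq ca => ->; rewrite adj_irr.
by apply: contraTneq ab => ->; rewrite adj_irr.
Qed.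

Section Complete.
Variable n : nat.
Definition complete_adj : rel 'I_n := fun i j => i != j.
Lemma complete_sym : symmetric complete_adj.
Proof. by move=> i j; rewrite /complete_adj eq_sym. Qed.
Lemma complete_irr : irreflexive complete_adj.
Proof. by move=> i; rewrite /complete_adj eqxx. Qed.
Definition complete : sgraph := SGraph complete_sym complete_irr.

Lemma deg_complete (v : complete) : deg v = n.-1.
Proof.
rewrite /deg -[X in _ = X.-1](card_ord n) -(cardC1 v); apply: eq_card => w.
by rewrite !inE eq_sym.
Qed.

Lemma alpha_complete : (alpha star_forest complete <= 2)%N.
Proof.
apply: alpha_le => S sf; rewrite leqNgt; apply/negP => /card_gt2P[a [b [c [[aS bS cS] [ab bc ca]]]]].
exact: (star_forest_triangle sf aS bS cS).
Qed.
End Complete.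

Section Pentagon.
Definition pentagon_adj : rel 'I_5 := fun i j => (j == i + 1) || (i == j + 1).
Lemma pentagon_sym : symmetric pentagon_adj.
Proof. by move=> i j; rewrite /pentagon_adj orbC. Qed.
Lemma pentagon_irr : irreflexive pentagon_adj.
Proof. by move=> i; rewrite /pentagon_adj orbb -subr_eq0 opprD addNKr. Qed.
Definition pentagon : sgraph := SGraph pentagon_sym pentagon_irr.

Lemma deg_pentagon (v : pentagon) : deg v = 2%N.
Proof.
have ne : (v + 1 : 'I_5) != v - 1 by rewrite (inj_eq (addrI v)).
rewrite /deg -[RHS](_ : #|[set (v + 1 : 'I_5); v - 1]| = 2%N); last by rewrite cards2 ne.
apply: eq_card => w; rewrite !inE /= /pentagon_adj; congr (_ || _).
by rewrite eq_sym -subr_eq eq_sym opprK.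
Qed.

Lemma pentagon_shift (j : 'I_5) :
  [/\ j + 1 != j, j + 1 + 1 != j, j + 1 + 1 + 1 != j & j + 1 + 1 + 1 + 1 != j].
Proof. by case: j => -[|[|[|[|[|]]]]]. Qed.

Lemma alpha_pentagon : (alpha star_forest pentagon <= 3)%N.
Proof.
apply: alpha_le => S sf; rewrite leqNgt; apply/negP => S4.
have [i iP] : exists i : 'I_5, forall j, j != i -> j \in S.
  have : (#|~: S| <= 1)%N.
    by have := cardsC S; rewrite card_ord; move: S4; lia.
  case: (set_0Vmem (~: S)) => [S0 _|[i iS] S1].
    by exists 0 => j _; have := in_set0 j; rewrite -S0 inE => /negbFE.
  exists i => j; apply: contraR => jS.
  by apply/eqP; apply: (card_le1_eqP S1); rewrite // inE.
have adj1 (j : 'I_5) : @adj pentagon j (j + 1) by rewrite /= /pentagon_adj eqxx.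
have [shift1 shift2 shift3 shift4] := pentagon_shift i.
have [_ far1 _ _] := pentagon_shift (i + 1).
have [_ far2 _ _] := pentagon_shift (i + 1 + 1).
apply: (star_forest_no_walk sf _ _ _ _ (adj1 (i + 1)) (adj1 _) (adj1 _)).
- exact/iP/shift1.
- exact/iP/shift2.
- exact/iP/shift3.
- exact/iP/shift4.
- by rewrite eq_sym.
- by rewrite eq_sym.
Qed.
End Pentagon.

Lemma card_pair_bool (T : finType) (A : {set T * bool}) :
  #|A| = (#|[set x | (x, true) \in A]| + #|[set x | (x, false) \in A]|)%N.
Proof.
have card_sum (I : finType) (B : {set I}) : #|B| = (\sum_i (i \in B))%N.
  by rewrite -sum1_card big_mkcond; apply: eq_bigr => i _; case: ifP.
rewrite !card_sum -big_split /=.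
transitivity (\sum_p ((p.1, p.2) \in A))%N; first by apply: eq_bigr => -[].
rewrite -(pair_bigA _ (fun x b => ((x, b) \in A) : nat)) /=.
by apply: eq_bigr => x _; rewrite big_bool !inE.
Qed.

(** The clique with a pendant vertex attached to each of its vertices; the
    clique vertices carry [true]. *)
Section Corona.
Variable n : nat.
Definition corona_adj : rel ('I_n * bool) :=
  fun u v => if u.1 == v.1 then u.2 != v.2 else u.2 && v.2.
Lemma corona_sym : symmetric corona_adj.
Proof. by move=> u v; rewrite /corona_adj eq_sym [u.2 == _]eq_sym andbC. Qed.
Lemma corona_irr : irreflexive corona_adj.
Proof. by move=> u; rewrite /corona_adj !eqxx. Qed.
Definition corona : sgraph := SGraph corona_sym corona_irr.

Lemma deg_corona (v : corona) : deg v = if v.2 then n else 1%N.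
Proof.
rewrite /deg card_pair_bool; case: v => i b /=.
have -> : [set x | (x, true) \in [set w | corona_adj (i, b) w]] =
          if b then ~: [set i] else [set i].
  apply/setP => x; rewrite !inE /corona_adj /= [i == x]eq_sym.
  by case: b; rewrite !inE; case: (x == i).
have -> : [set x | (x, false) \in [set w | corona_adj (i, b) w]] =
          if b then [set i] else set0.
  apply/setP => x; rewrite !inE /corona_adj /= [i == x]eq_sym.
  by case: b; rewrite !inE; case: (x == i).
case: b; rewrite ?cards1 ?cards0 ?addn0 // cardsC1 card_ord addn1.
by rewrite prednK // (leq_ltn_trans _ (ltn_ord i)).
Qed.

(** Two clique vertices in a star forest cannot both keep their pendant
    vertices, and three clique vertices form a triangle. *)
Lemma alpha_corona : (alpha star_forest corona <= n.+1)%N.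
Proof.
apply: alpha_le => S sf; rewrite card_pair_bool.
set K := [set x | (x, true) \in S]; set L := [set x | (x, false) \in S].
have Ln : (#|L| <= n)%N by rewrite -[X in (_ <= X)%N](card_ord n) max_card.
case: (leqP #|K| 1) => [K1|]; first by rewrite -addn1 addnC leq_add.
case/card_gt1P => i [j [iK jK ij]].
have /[!inE] iS := iK; have /[!inE] jS := jK.
have adjK x y : x != y -> @adj corona (x, true) (y, true).
  by move=> xy; rewrite /= /corona_adj /= (negbTE xy).
have K2 : (#|K| <= 2)%N.
  rewrite leqNgt; apply/negP => /card_gt2P[a [b [c [[+ + +] [ab bc ca]]]]].
  rewrite !inE => aS bS cS.
  by apply: (star_forest_triangle sf aS bS cS); apply: adjK.
have : (#|L| < n)%N.
  rewrite ltn_neqAle Ln andbT; apply/negP => /eqP Ln'.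
  have LT x : (x, false) \in S.
    have /setP/(_ x) : L = setT by apply/eqP; rewrite eqEcard subsetT cardsT card_ord Ln' /=.
    by rewrite !inE.
  apply: (star_forest_no_walk sf (LT i) iS jS (LT j)).
  - by rewrite /= /corona_adj /= eqxx.
  - exact: adjK.
  - by rewrite /= /corona_adj /= eqxx.
  - by rewrite xpair_eqE andbF.
  - by rewrite xpair_eqE andbF.
by move: K2; lia.
Qed.
End Corona.

Section LowerBounds.
Variable R : realType.
Implicit Types (f g : nat -> R) (eps : R).

Lemma lower_bound_complete f d : lower_bound star_forest f -> f d <= 2 / (d%:R + 1).
Proof.
case=> _ /(_ (complete d.+1)).
under eq_bigr do rewrite deg_complete.
rewrite sumr_const card_ord => h.
have le2 : (alpha star_forest (complete d.+1))%:R <= 2%:R :> R by rewrite ler_nat alpha_complete.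
move: (le_trans h le2).
by rewrite natr1 ler_pdivlMr ?ltr0n // mulr_natr.
Qed.

Lemma lower_bound_pentagon f : lower_bound star_forest f -> f 2 <= 3 / 5.
Proof.
case=> _ /(_ pentagon).
under eq_bigr do rewrite deg_pentagon.
rewrite sumr_const card_ord => h.
have le3 : (alpha star_forest pentagon)%:R <= 3%:R :> R by rewrite ler_nat alpha_pentagon.
move: (le_trans h le3).
by rewrite ler_pdivlMr // mulr_natr.
Qed.

Lemma lower_bound_corona f d : lower_bound star_forest f -> (0 < d)%N ->
  f d <= 1 / d%:R + (1 - f 1%N).
Proof.
case=> _ /(_ (corona d)); under eq_bigr do rewrite deg_corona.
rewrite -(pair_bigA _ (fun (i : 'I_d) (b : bool) => f (if b then d else 1%N))) /=.
under eq_bigr do rewrite big_bool /=.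
rewrite sumr_const card_ord => h d0.
have le_d : (alpha star_forest (corona d))%:R <= d.+1%:R :> R by rewrite ler_nat alpha_corona.
move: (le_trans h le_d).
have d0R : 0 < d%:R :> R by rewrite ltr0n.
rewrite -[_ *+ d]mulr_natr -[d.+1%:R]natr1 -ler_pdivlMr // mulrDl divff ?gt_eqF //.
by move: (_ / _) => q; lra.
Qed.

(** The corona bounds [f d] by [1 / d] plus the deficit of [f] at leaves, so that
    deficit is the parameter. *)
Lemma lower_bound_dominated f d : lower_bound star_forest f ->
  f d <= f_eps (1 - f 1%N) d.
Proof.
move=> lf; have [/(_ d)/andP[_ f1] _] := lf.
case: d f1 => [|[|[|d]]] f1 //; first by rewrite f_eps1 opprB addrC subrK.
  by rewrite /f_eps le_min lower_bound_pentagon // (@lower_bound_corona f 2).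
by rewrite /f_eps le_min lower_bound_complete // lower_bound_corona.
Qed.

Lemma f_eps_unit eps : 0 <= eps <= 1 / 6 -> unit_valued (f_eps eps).
Proof.
move=> /andP[e0 e1] [|[|[|d]]].
- by rewrite /f_eps; lra.
- by rewrite f_eps1; lra.
- by rewrite /f_eps le_min ge_min; apply/andP; split; [apply/andP; split|apply/orP; left]; lra.
have d0 : 0 <= d.+3%:R :> R by exact: ler0n.
apply/andP; split.
  rewrite /f_eps; move: (d.+3%:R : R) d0 => x x0; rewrite le_min.
  by apply/andP; split; rewrite ?addr_ge0 // divr_ge0 ?addr_ge0 //.
apply: le_trans (f_eps_le_cap eps _) _ => //.
rewrite ler_pdivrMr ?ltr_wpDl // mul1r.
by rewrite -addn3 natrD; have := ler0n R d; lra.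
Qed.

(** Degree 3 detects [eps] on the whole range up to [1 / 6], the value from which
    on the cap takes over. *)
Lemma f_eps3 eps : eps <= 1 / 6 -> f_eps eps 3 = 1 / 3 + eps.
Proof. by move=> e1; rewrite /f_eps min_r // (_ : 2 / (3 + 1) = 1 / 2 :> R); [lra | field]. Qed.

Lemma f_eps_lower_bound eps : 0 <= eps <= 1 / 6 -> lower_bound star_forest (f_eps eps).
Proof. by move=> e; split=> [|G]; [apply: f_eps_unit | apply: lower_bound_eps]. Qed.

(** If [f_eps + g] is a lower bound, it lies below the function with parameter
    [eps - g 1], by [lower_bound_dominated]. At degree 3 this forces
    [g 1 = 0], and then it says that [g] vanishes. *)
Lemma f_eps_extremal eps : 0 <= eps <= 1 / 6 -> extremal star_forest (f_eps eps).
Proof.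
move=> e; split; first exact: f_eps_lower_bound.
case=> g [g01 gn0 lg]; apply: gn0.
have g0 d : 0 <= g d by case/andP: (g01 d).
have dom d := lower_bound_dominated d lg.
have e1 : 1 - (f_eps eps 1 + g 1%N) = eps - g 1%N by rewrite f_eps1; lra.
have g1 : g 1%N = 0.
  have := dom 3%N; rewrite e1 !f_eps3; try by have := g0 1%N; move/andP: e => [_]; lra.
  by move=> h; have := g0 1%N; have := g0 3%N; lra.
move=> d; have := dom d; rewrite e1 g1 subr0.
by have := g0 d; lra.
Qed.

(** A deficit above [1 / 6] at leaves brings nothing elsewhere, since the cap and
    the pentagon already limit the other degrees. *)
Lemma dominated_f_eps f : lower_bound star_forest f ->
  exists eps, 0 <= eps <= 1 / 6 /\ dominated f (f_eps eps).
Proof.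
move=> lf; have [/(_ 1%N)/andP[f0 f1] _] := lf.
have [le|lt] := leP (1 - f 1%N) (1 / 6).
  by exists (1 - f 1%N); split=> [|d]; [lra | apply: lower_bound_dominated].
exists (1 / 6); split=> [|d]; first lra.
case: d => [|[|[|d]]].
- by case: lf => /(_ 0%N)/andP[_].
- by rewrite f_eps1; lra.
- by rewrite f_sixth2 lower_bound_pentagon.
- by rewrite f_sixth_cap // lower_bound_complete.
Qed.
End LowerBounds.

Theorem theorem7 (R : realType) :
  (forall eps : R, 0 <= eps <= 1 / 6 ->
     [/\ unit_valued (f_eps eps),
         forall G : sgraph,
           (alpha star_forest G)%:R >= \sum_(v : G) f_eps eps (deg v) &
         extremal star_forest (f_eps eps)]) /\
  (forall f : nat -> R, lower_bound star_forest f ->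
     exists eps : R,
       [/\ 0 <= eps <= 1 / 6,
           lower_bound star_forest (f_eps eps) &
           dominated f (f_eps eps)]).
Proof.
split=> [eps e|f lf].
  split; [exact: f_eps_unit | by move=> G; apply: lower_bound_eps | exact: f_eps_extremal].
have [eps [e dom]] := dominated_f_eps lf.
by exists eps; split=> //; apply: f_eps_lower_bound.
Qed.
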